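(* Let $H$ be a coquasi-bialgebra and $(R,\cdot,\sigma)$ an $H$-crossed system. Then the category of right coquasi-Hopf modules $(\mathcal{M}_R^H)_H$ is isomorphic to the category of right $(H,R\overline{\#}_{\sigma}H)$-Hopf modules $\mathcal{M}_{R\overline{\#}_{\sigma}H}^H$.
   Context: All vector spaces, algebras and tensor products are over a fixed field $\Bbbk$; Sweedler notation is used: $\Delta(h)=h_1\otimes h_2$, $\rho(m)=m_0\otimes m_1$. Coquasi-bialgebra: a coassociative counital coalgebra $(H,\Delta,\varepsilon)$ with coalgebra morphisms $m:H\otimes H\to H$ (written $h\otimes g\mapsto hg$) and $u:\Bbbk\to H$ (with $u(1)=1_H$), and a convolution invertible $\omega\in(H\otimes H\otimes H)^*$ such that for all $h,g,k,l\in H$: $h_1(g_1k_1)\omega(h_2,g_2,k_2)=\omega(h_1,g_1,k_1)(h_2g_2)k_2$; $1_Hh=h1_H=h$; $\omega(h_1,g_1,k_1l_1)\omega(h_2g_2,k_2,l_2)=\omega(g_1,k_1,l_1)\omega(h_1,g_2k_2,l_2)\omega(h_2,g_3,k_3)$; $\omega(h,1_H,g)=\varepsilon(h)\varepsilon(g)$. $H$-crossed system $(R,\cdot,\sigma)$: an associative unital algebra $R$, a bilinear map $\cdot:H\otimes R\to R$ and a linear map $\sigma:H\otimes H\to R$ such that for all $h,g,l\in H$, $r,s\in R$: $h\cdot(rs)=(h_1\cdot r)(h_2\cdot s)$, $h\cdot 1_R=\varepsilon(h)1_R$, $1_H\cdot r=r$, $[h_1\cdot(g_1\cdot r)]\sigma(h_2,g_2)=\sigma(h_1,g_1)[(h_2g_2)\cdot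 r]$, $\sigma(h,1_H)=\sigma(1_H,h)=\varepsilon(h)1_R$, $[h_1\cdot\sigma(g_1,l_1)]\sigma(h_2,g_2l_2)=\sigma(h_1,g_1)\sigma(h_2g_2,l_1)\omega^{-1}(h_3,g_3,l_2)$. Crossed product: $R\overline{\#}_{\sigma}H=R\otimes H$ with multiplication $(r\overline{\#}_{\sigma}h)(s\overline{\#}_{\sigma}g)=r(h_1\cdot s)\sigma(h_2,g_1)\overline{\#}_{\sigma}h_3g_2$, unit $1_R\overline{\#}_{\sigma}1_H$, coaction $I_R\otimes\Delta$. It is a right $H$-comodule algebra, i.e. a right $H$-comodule $A$ with colinear multiplication and colinear unit and $(ab)c=a_0(b_0c_0)\omega(a_1,b_1,c_1)$. Right $(H,A)$-Hopf modules $\mathcal{M}_A^H$, for a right $H$-comodule algebra $A$: right $H$-comodules $(M,\rho_M)$ with a map $M\otimes A\to M$ such that $(ma)b=m_0(a_0b_0)\omega(m_1,a_1,b_1)$, $m1_A=m$, $\rho_M(ma)=m_0a_0\otimes m_1a_1$; morphisms are the right $H$-colinear maps respecting the $A$-action. Category $\mathcal{M}_R^H$: right $R$-modules that are right $H$-comodules with $\rho_M(mr)=m_0r\otimes m_1$. Right $(R,H)$-coquasi-Hopf module: an object $M$ of $\mathcal{M}_R^H$ with a linear map $\circ:M\otimes H\to M$ such that for all $m\in M$, $h,g\in H$, $r\in R$: $\rho_M(m\circ h)=m_0\circ h_1\otimes m_1h_2$; $(m\circ h)r=[m(h_1\cdot r)]\circ h_2$; $(m\circ h)\circ g=[m_0\sigma(h_1,g_1)]\circ(h_2g_2)\,\omega(m_1,h_3,g_3)$;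 $m\circ 1_H=m$. $(\mathcal{M}_R^H)_H$ is the category of these; morphisms are the right $R$-linear, right $H$-colinear maps commuting with $\circ$. *)

(* Defs.v *)
From HB Require Import structures.
From mathcomp Require Import all_boot all_algebra.
From mathcomp Require Import boolp.

Set Implicit Arguments.
Unset Strict Implicit.
Unset Printing Implicit Defensive.

Import GRing.Theory.

Local Open Scope ring_scope.
Local Open Scope quotient_scope.

Reserved Notation "x ⊗ y" (at level 45, left associativity).
Reserved Notation "\tsum_ ( x , y <- t ) F"
  (at level 46, right associativity, x binder, y binder,
   format "'[' \tsum_ ( x ,  y  <-  t ) '/  '  F ']'").

Definition bilin (k : fieldType) (V W U : lmodType k) (f : V -> W -> U) : Prop :=
  (forall w, linear (f^~ w)) /\ (forall v, linear (f v)).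

(* V ⊗ W, in any dimension, is the quotient of the formal sums                *)
(* v_1 ⊗ w_1 + ... + v_n ⊗ w_n, encoded as sequences of pairs, identifying    *)
(* two sums when every bilinear map takes the same value on both; its         *)
(* universal property is tsum_linear, tsum_pure (existence) and tensor_ext    *)
(* (uniqueness).                                                              *)
Section TensorProduct.
Variables (k : fieldType) (V W : lmodType k).

Definition tens_eq (s t : seq (V * W)) : bool :=
  `[< forall (U : lmodType k) (f : V -> W -> U), bilin f ->
        \sum_(p <- s) f p.1 p.2 = \sum_(p <- t) f p.1 p.2 >].

Lemma tens_eq_refl : reflexive tens_eq.
Proof. by move=> s; apply/asboolP. Qed.

Lemma tens_eq_sym : symmetric tens_eq.
Proof.
by move=> s t; apply/asboolP/asboolP => h U f bf; rewrite h.
Qed.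

Lemma tens_eq_trans : transitive tens_eq.
Proof.
move=> t s u /asboolP h1 /asboolP h2; apply/asboolP => U f bf.
by rewrite h1 // h2.
Qed.

Canonical tens_eqv := EquivRel tens_eq tens_eq_refl tens_eq_sym tens_eq_trans.

Definition tensor_sort := {eq_quot tens_eqv}.
HB.instance Definition _ := Choice.on tensor_sort.

Definition tsum (U : nmodType) (f : V -> W -> U) (t : tensor_sort) : U :=
  \sum_(p <- repr t) f p.1 p.2.

Definition pure (v : V) (w : W) : tensor_sort := \pi_tensor_sort [:: (v, w)].

Lemma tsum_pi (U : lmodType k) (f : V -> W -> U) (s : seq (V * W)) :
  bilin f -> tsum f (\pi_tensor_sort s) = \sum_(p <- s) f p.1 p.2.
Proof.
move=> bf; rewrite /tsum.
have: repr (\pi_tensor_sort s) = s %[mod tensor_sort] by rewrite reprK.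
by move/eqmodP/asboolP; apply.
Qed.

Lemma tens_sep (s t : tensor_sort) :
  (forall (U : lmodType k) (f : V -> W -> U), bilin f -> tsum f s = tsum f t) ->
  s = t.
Proof.
move=> h; rewrite -[s]reprK -[t]reprK; apply/eqmodP/asboolP => U f bf.
by have := h U f bf.
Qed.

Definition tens_add (s t : tensor_sort) : tensor_sort := \pi_tensor_sort (repr s ++ repr t).
Definition tens_zero : tensor_sort := \pi_tensor_sort [::].
Definition tens_scale (a : k) (s : tensor_sort) : tensor_sort :=
  \pi_tensor_sort [seq (a *: p.1, p.2) | p <- repr s].
Definition tens_opp (s : tensor_sort) : tensor_sort := tens_scale (- 1) s.

Lemma tsum_add (U : lmodType k) (f : V -> W -> U) s t : bilin f ->
  tsum f (tens_add s t) = tsum f s + tsum f t.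
Proof. by move=> bf; rewrite tsum_pi // big_cat. Qed.

Lemma tsum_zero (U : lmodType k) (f : V -> W -> U) : bilin f ->
  tsum f tens_zero = 0.
Proof. by move=> bf; rewrite tsum_pi // big_nil. Qed.

Lemma tsum_scale (U : lmodType k) (f : V -> W -> U) a s : bilin f ->
  tsum f (tens_scale a s) = a *: tsum f s.
Proof.
move=> bf; rewrite tsum_pi // big_map scaler_sumr; apply: eq_bigr => p _ /=.
by have [fl _] := bf; rewrite (scalable_linear (fl p.2)).
Qed.

Lemma tens_addA : associative tens_add.
Proof. by move=> s t u; apply: tens_sep => U f bf; rewrite !tsum_add // addrA. Qed.

Lemma tens_addC : commutative tens_add.
Proof. by move=> s t; apply: tens_sep => U f bf; rewrite !tsum_add // addrC. Qed.

Lemma tens_add0 : left_id tens_zero tens_add.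
Proof.
by move=> s; apply: tens_sep => U f bf; rewrite tsum_add // tsum_zero // add0r.
Qed.

Lemma tens_addN : left_inverse tens_zero tens_opp tens_add.
Proof.
move=> s; apply: tens_sep => U f bf.
by rewrite tsum_add // tsum_zero // tsum_scale // scaleN1r addNr.
Qed.

HB.instance Definition _ :=
  GRing.isZmodule.Build tensor_sort tens_addA tens_addC tens_add0 tens_addN.

Lemma tens_scaleA a b s : tens_scale a (tens_scale b s) = tens_scale (a * b) s.
Proof. by apply: tens_sep => U f bf; rewrite !tsum_scale // scalerA. Qed.

Lemma tens_scale1 : left_id 1 tens_scale.
Proof. by move=> s; apply: tens_sep => U f bf; rewrite tsum_scale // scale1r. Qed.

Lemma tens_scaleDr : right_distributive tens_scale +%R.
Proof.
move=> a s t; apply: tens_sep => U f bf.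
by rewrite tsum_scale // [s + t]/(tens_add s t) tsum_add // scalerDr
  [_ + _ in RHS]/(tens_add _ _) tsum_add // !tsum_scale.
Qed.

Lemma tens_scaleDl s : {morph tens_scale^~ s : a b / a + b}.
Proof.
move=> a b; apply: tens_sep => U f bf.
by rewrite tsum_scale // scalerDl [_ + _ in RHS]/(tens_add _ _) tsum_add //
  !tsum_scale.
Qed.

HB.instance Definition _ := GRing.Zmodule_isLmodule.Build k tensor_sort
  tens_scaleA tens_scale1 tens_scaleDr tens_scaleDl.

Definition tensor : lmodType k := tensor_sort.

Lemma tsum_linear (U : lmodType k) (f : V -> W -> U) :
  bilin f -> linear (tsum f).
Proof.
move=> bf a s t.
by rewrite [a *: s + t]/(tens_add (tens_scale a s) t) tsum_add // tsum_scale.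
Qed.

Lemma tsum_pure (U : lmodType k) (f : V -> W -> U) v w :
  bilin f -> tsum f (pure v w) = f v w.
Proof. by move=> bf; rewrite tsum_pi // big_seq1. Qed.

Lemma pure_bilin : bilin pure.
Proof.
split=> [w a u v|v a u w]; apply: tens_sep => U f bf.
  by rewrite (tsum_linear bf) !tsum_pure //; have [-> _] := bf.
by rewrite (tsum_linear bf) !tsum_pure //; have [_ ->] := bf.
Qed.

Lemma tens_pureE (t : tensor) : t = tsum pure t.
Proof.
rewrite /tsum -{1}[t]reprK; elim: (repr t) => [|p s ih]; first by rewrite big_nil.
rewrite big_cons -ih; apply: tens_sep => U f bf.
by rewrite [_ + _ in RHS]/(tens_add _ _) tsum_add // !tsum_pi // big_cons big_seq1.
Qed.

Lemma eq_tsum (U : nmodType) (f g : V -> W -> U) t :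
  (forall v w, f v w = g v w) -> tsum f t = tsum g t.
Proof. by move=> e; apply: eq_bigr => p _. Qed.

Lemma linear_tsum (U U' : lmodType k) (g : U -> U') (f : V -> W -> U) t :
  linear g -> g (tsum f t) = tsum (fun v w => g (f v w)) t.
Proof.
move=> lg; rewrite /tsum; pose G := GRing.isLinear.Build _ _ _ _ g lg.
pose g' : {linear U -> U'} := HB.pack g G.
by rewrite -[g]/(g' : U -> U') raddf_sum.
Qed.

Lemma tensor_ext (U : lmodType k) (f g : tensor -> U) :
  linear f -> linear g -> (forall v w, f (pure v w) = g (pure v w)) -> f =1 g.
Proof.
move=> lf lg e t; rewrite [t]tens_pureE !linear_tsum //.
exact: eq_tsum.
Qed.

End TensorProduct.

Arguments tensor {k} (V W)%_type_scope.
Arguments tsum {k V W U} f t.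
Arguments pure {k V W} v w.

Notation "V ⊗ W" := (tensor V W) : type_scope.
Notation "v ⊗ w" := (pure v w) : ring_scope.
(* Sweedler notation: the value at t = sum_i x_i ⊗ y_i of the linear map      *)
(* induced by the bilinear expression F of x and y.  It is computed on a      *)
(* representative of t, so it is meaningful only for F bilinear in (x, y).    *)
Notation "\tsum_ ( x , y <- t ) F" := (tsum (fun x y => F) t) : ring_scope.

(* Unlike algType, this allows the zero algebra. *)
Record algebra (k : fieldType) := Algebra {
  alg_sort :> lmodType k;
  amul : alg_sort -> alg_sort -> alg_sort;
  aone : alg_sort;
  amul_bilin : bilin amul;
  amulA : associative amul;
  amul1r : left_id aone amul;
  amulr1 : right_id aone amul
}.

Arguments amul {k _} _ _.
Arguments aone {k _}.

(* Triple tensors are bracketed to the left: V ⊗ V ⊗ V is (V ⊗ V) ⊗ V.        *)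
(* Iterated coproducts are written h1 ⊗ h2 ⊗ h3 with Δ h = h1 ⊗ h' and        *)
(* Δ h' = h2 ⊗ h3; by coassociativity the bracketing is immaterial.           *)
Record coalgebra (k : fieldType) := Coalgebra {
  coalg_sort :> lmodType k;
  Delta : {linear coalg_sort -> (coalg_sort ⊗ coalg_sort)%type};
  counit : {scalar coalg_sort};
  coassoc : forall h,
    \tsum_(h1, h2 <- Delta h) \tsum_(h11, h12 <- Delta h1) h11 ⊗ h12 ⊗ h2
    = \tsum_(h1, h2 <- Delta h) \tsum_(h21, h22 <- Delta h2) h1 ⊗ h21 ⊗ h22;
  counitl : forall h, \tsum_(h1, h2 <- Delta h) counit h1 *: h2 = h;
  counitr : forall h, \tsum_(h1, h2 <- Delta h) counit h2 *: h1 = h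
}.

Notation Δ := (@Delta _ _).
Notation ε := (@counit _ _).

(* A linear form on H ⊗ H ⊗ H is given as a trilinear form on H. *)
Definition trilin_form (k : fieldType) (V : lmodType k) (f : V -> V -> V -> k) :
    Prop :=
  [/\ forall y z, scalar (fun x => f x y z),
      forall x z, scalar (fun y => f x y z)
    & forall x y, scalar (fun z => f x y z)].

Record coquasi_bialgebra (k : fieldType) := CoquasiBialgebra {
  cq_coalg :> coalgebra k;
  cmul : cq_coalg -> cq_coalg -> cq_coalg;
  cone : cq_coalg;
  omega : cq_coalg -> cq_coalg -> cq_coalg -> k;
  (* the convolution inverse of omega, which is unique *)
  omega_inv : cq_coalg -> cq_coalg -> cq_coalg -> k;
  cmul_bilin : bilin cmul;
  Delta_mul : forall h g,
    Δ (cmul h g)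
    = \tsum_(h1, h2 <- Δ h) \tsum_(g1, g2 <- Δ g) cmul h1 g1 ⊗ cmul h2 g2;
  counit_mul : forall h g, ε (cmul h g) = ε h * ε g;
  Delta_one : Δ cone = cone ⊗ cone;
  counit_one : ε cone = 1;
  omega_trilin : trilin_form omega;
  omega_inv_trilin : trilin_form omega_inv;
  omega_omega_inv : forall h g l,
    \tsum_(h1, h2 <- Δ h) \tsum_(g1, g2 <- Δ g) \tsum_(l1, l2 <- Δ l)
      omega h1 g1 l1 * omega_inv h2 g2 l2 = ε h * ε g * ε l;
  omega_inv_omega : forall h g l,
    \tsum_(h1, h2 <- Δ h) \tsum_(g1, g2 <- Δ g) \tsum_(l1, l2 <- Δ l)
      omega_inv h1 g1 l1 * omega h2 g2 l2 = ε h * ε g * ε l;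
  cmul_quasi_assoc : forall h g l,
    \tsum_(h1, h2 <- Δ h) \tsum_(g1, g2 <- Δ g) \tsum_(l1, l2 <- Δ l)
      omega h2 g2 l2 *: cmul h1 (cmul g1 l1)
    = \tsum_(h1, h2 <- Δ h) \tsum_(g1, g2 <- Δ g) \tsum_(l1, l2 <- Δ l)
      omega h1 g1 l1 *: cmul (cmul h2 g2) l2;
  cmul1h : left_id cone cmul;
  cmulh1 : right_id cone cmul;
  omega_cocycle : forall h g l n,
    \tsum_(h1, h2 <- Δ h) \tsum_(g1, g2 <- Δ g)
    \tsum_(l1, l2 <- Δ l) \tsum_(n1, n2 <- Δ n)
      omega h1 g1 (cmul l1 n1) * omega (cmul h2 g2) l2 n2
    = \tsum_(h1, h2 <- Δ h)
      \tsum_(g1, g' <- Δ g) \tsum_(g2, g3 <- Δ g')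
      \tsum_(l1, l' <- Δ l) \tsum_(l2, l3 <- Δ l')
      \tsum_(n1, n2 <- Δ n)
        omega g1 l1 n1 * omega h1 (cmul g2 l2) n2 * omega h2 g3 l3;
  omega_one : forall h g, omega h cone g = ε h * ε g
}.

Arguments cmul {k _} _ _.
Arguments cone {k _}.
Arguments omega {k _} _ _ _.
Arguments omega_inv {k _} _ _ _.

Record comodule (k : fieldType) (H : coalgebra k) := Comodule {
  comod_sort :> lmodType k;
  coact : {linear comod_sort -> (comod_sort ⊗ H)%type};
  coact_coassoc : forall m,
    \tsum_(m0, m1 <- coact m) \tsum_(m00, m01 <- coact m0) m00 ⊗ m01 ⊗ m1
    = \tsum_(m0, m1 <- coact m) \tsum_(h1, h2 <- Δ m1) m0 ⊗ h1 ⊗ h2;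
  coact_counit : forall m, \tsum_(m0, m1 <- coact m) ε m1 *: m0 = m
}.

Notation ρ := (@coact _ _ _).

Definition colinear (k : fieldType) (H : coalgebra k) (M N : comodule H)
    (f : M -> N) : Prop :=
  forall m, ρ (f m) = \tsum_(m0, m1 <- ρ m) f m0 ⊗ m1.

Record comodule_algebra (k : fieldType) (H : coquasi_bialgebra k) :=
    ComoduleAlgebra {
  ca_comod :> comodule H;
  camul : ca_comod -> ca_comod -> ca_comod;
  caone : ca_comod;
  camul_bilin : bilin camul;
  coact_camul : forall a b,
    ρ (camul a b)
    = \tsum_(a0, a1 <- ρ a) \tsum_(b0, b1 <- ρ b) camul a0 b0 ⊗ cmul a1 b1;
  coact_caone : ρ caone = caone ⊗ cone;
  camul1a : left_id caone camul;
  camula1 : right_id caone camul;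
  camul_quasi_assoc : forall a b c,
    camul (camul a b) c
    = \tsum_(a0, a1 <- ρ a) \tsum_(b0, b1 <- ρ b) \tsum_(c0, c1 <- ρ c)
        omega a1 b1 c1 *: camul a0 (camul b0 c0)
}.

Arguments camul {k H _} _ _.
Arguments caone {k H _}.

Record crossed_system (k : fieldType) (H : coquasi_bialgebra k)
    (R : algebra k) := CrossedSystem {
  act : H -> R -> R;
  sigma : H -> H -> R;
  act_bilin : bilin act;
  sigma_bilin : bilin sigma;
  act_mul : forall h r s,
    act h (amul r s) = \tsum_(h1, h2 <- Δ h) amul (act h1 r) (act h2 s);
  act_one : forall h, act h aone = ε h *: aone;
  one_act : forall r, act cone r = r;
  act_sigma : forall h g r,
    \tsum_(h1, h2 <- Δ h) \tsum_(g1, g2 <- Δ g)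
      amul (act h1 (act g1 r)) (sigma h2 g2)
    = \tsum_(h1, h2 <- Δ h) \tsum_(g1, g2 <- Δ g)
      amul (sigma h1 g1) (act (cmul h2 g2) r);
  sigma_h1 : forall h, sigma h cone = ε h *: aone;
  sigma_1h : forall h, sigma cone h = ε h *: aone;
  sigma_cocycle : forall h g l,
    \tsum_(h1, h2 <- Δ h) \tsum_(g1, g2 <- Δ g) \tsum_(l1, l2 <- Δ l)
      amul (act h1 (sigma g1 l1)) (sigma h2 (cmul g2 l2))
    = \tsum_(h1, h' <- Δ h) \tsum_(h2, h3 <- Δ h')
      \tsum_(g1, g' <- Δ g) \tsum_(g2, g3 <- Δ g') \tsum_(l1, l2 <- Δ l)
        omega_inv h3 g3 l2 *: amul (sigma h1 g1) (sigma (cmul h2 g2) l1)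
}.

Arguments act {k H R} _ _ _.
Arguments sigma {k H R} _ _ _.

Section LinearityLemmas.
Variable k : fieldType.
Implicit Types U V W X : lmodType k.

Lemma lin_id V : linear (fun x : V => x).
Proof. by []. Qed.

Lemma lin_app U V W (f : {linear V -> W}) (g : U -> V) :
  linear g -> linear (fun x => f (g x)).
Proof. by move=> lg a x y; rewrite lg linearP. Qed.

Lemma lin_comp U V W (f : V -> W) (g : U -> V) :
  linear f -> linear g -> linear (fun x => f (g x)).
Proof. by move=> lf lg a x y; rewrite lg lf. Qed.

Lemma lin_bl U V W X (f : V -> W -> X) (g : U -> V) w :
  bilin f -> linear g -> linear (fun x => f (g x) w).
Proof. by move=> [lf _] lg a x y; rewrite lg lf. Qed.

Lemma lin_br U V W X (f : V -> W -> X) (g : U -> W) v :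
  bilin f -> linear g -> linear (fun x => f v (g x)).
Proof. by move=> [_ lf] lg a x y; rewrite lg lf. Qed.

Lemma lin_bilr U V W (f : U -> V -> W) u : bilin f -> linear (f u).
Proof. by case. Qed.

Lemma lin_scalel U V (f : U -> k) (v : V) :
  scalar f -> linear (fun x => f x *: v).
Proof. by move=> lf a x y; rewrite lf scalerDl scalerA. Qed.

Lemma lin_scaler U V (f : U -> V) (b : k) :
  linear f -> linear (fun x => b *: f x).
Proof. by move=> lf a x y; rewrite lf scalerDr !scalerA mulrC. Qed.

Lemma lin_tsum_body U V W X (F : V -> W -> U -> X) (t : V ⊗ W) :
  (forall v w, linear (F v w)) -> linear (fun x => \tsum_(v, w <- t) F v w x).
Proof.
move=> lF a x y; rewrite /tsum scaler_sumr -big_split /=.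
by apply: eq_bigr => p _; rewrite lF.
Qed.

Lemma lin_tsum U V W X (F : V -> W -> X) (t : U -> V ⊗ W) :
  bilin F -> linear t -> linear (fun x => tsum F (t x)).
Proof. by move=> bF lt a x y; rewrite lt tsum_linear. Qed.

Lemma scal_lin U V (f : {scalar V}) (g : U -> V) :
  linear g -> scalar (fun x => f (g x)).
Proof. by move=> lg a x y; rewrite lg linearP. Qed.

Lemma scal_fun U V (f : V -> k) (g : U -> V) :
  scalar f -> linear g -> scalar (fun x => f (g x)).
Proof. by move=> lf lg a x y; rewrite lg lf. Qed.

Lemma scal_mull U (f : U -> k) (b : k) : scalar f -> scalar (fun x => f x * b).
Proof. by move=> lf a x y; rewrite lf mulrDl mulrA. Qed.

Lemma scal_mulr U (f : U -> k) (b : k) : scalar f -> scalar (fun x => b * f x).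
Proof. by move=> lf a x y; rewrite lf mulrDr mulrCA. Qed.

End LinearityLemmas.

Definition trilin (k : fieldType) (V1 V2 V3 U : lmodType k)
    (f : V1 -> V2 -> V3 -> U) : Prop :=
  [/\ forall y z, linear (fun x => f x y z),
      forall x z, linear (fun y => f x y z)
    & forall x y, linear (fun z => f x y z)].

Section TrilinLemmas.
Variables (k : fieldType) (V1 V2 V3 X U : lmodType k) (f : V1 -> V2 -> V3 -> U).
Hypothesis tf : trilin f.

Lemma lin_t1 (g : X -> V1) y z : linear g -> linear (fun x => f (g x) y z).
Proof. by have [h _ _] := tf; exact: lin_comp (h y z). Qed.
Lemma lin_t2 (g : X -> V2) x z : linear g -> linear (fun y => f x (g y) z).
Proof. by have [_ h _] := tf; exact: lin_comp (h x z). Qed.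
Lemma lin_t3 (g : X -> V3) x y : linear g -> linear (fun z => f x y (g z)).
Proof. by have [_ _ h] := tf; exact: lin_comp (h x y). Qed.
End TrilinLemmas.

Section TrilinFormLemmas.
Variables (k : fieldType) (V X : lmodType k) (f : V -> V -> V -> k).
Hypothesis tf : trilin_form f.

Lemma scal_t1 (g : X -> V) y z : linear g -> scalar (fun x => f (g x) y z).
Proof. by have [h _ _] := tf; exact: scal_fun (h y z). Qed.
Lemma scal_t2 (g : X -> V) x z : linear g -> scalar (fun y => f x (g y) z).
Proof. by have [_ h _] := tf; exact: scal_fun (h x z). Qed.
Lemma scal_t3 (g : X -> V) x y : linear g -> scalar (fun z => f x y (g z)).
Proof. by have [_ _ h] := tf; exact: scal_fun (h x y). Qed.
End TrilinFormLemmas.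

Ltac lin_base := first
  [ exact: pure_bilin | exact: amul_bilin | exact: cmul_bilin
  | exact: act_bilin | exact: sigma_bilin
  | exact: omega_trilin | exact: omega_inv_trilin | assumption ].

Ltac lin := cbv beta; lazymatch goal with
  | |- bilin _ => first [ lin_base | split; intros ?; lin ]
  | |- trilin _ => first [ assumption | split; intros ? ?; lin ]
  | |- trilin_form _ => lin_base
  | |- GRing.linear_for _ (fun x => _ *: _) => first
     [ apply: lin_scalel; lin | apply: lin_scaler; lin ]
  | |- GRing.linear_for _ (fun x => tsum _ _) => first
     [ apply: lin_tsum_body; intros ? ?; lin | apply: lin_tsum; [lin | lin] ]
  | |- GRing.linear_for _ (fun x => _ * _) => first
     [ apply: scal_mull; lin | apply: scal_mulr; lin ]
  | |- GRing.linear_for _ _ => first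
     [ exact: lin_id | exact: linearP | assumption
     | apply: lin_bilr; lin_base
     | apply: lin_app; lin
     | apply: lin_bl; [lin_base | lin]
     | apply: lin_br; [lin_base | lin]
     | apply: lin_t1; [assumption | lin]
     | apply: lin_t2; [assumption | lin]
     | apply: lin_t3; [assumption | lin]
     | apply: scal_lin; lin
     | apply: scal_t1; [lin_base | lin]
     | apply: scal_t2; [lin_base | lin]
     | apply: scal_t3; [lin_base | lin] ]
  end.

Lemma tsum_exchange (k : fieldType) (V W V' W' : lmodType k) (U : nmodType)
    (F : V -> W -> V' -> W' -> U) (s : V ⊗ W) (t : V' ⊗ W') :
  \tsum_(v, w <- s) \tsum_(v', w' <- t) F v w v' w'
  = \tsum_(v', w' <- t) \tsum_(v, w <- s) F v w v' w'.
Proof. exact: exchange_big. Qed.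

Section Convolution.
Variables (k : fieldType) (H : coalgebra k).
Implicit Types U V W X Y Z : lmodType k.

Lemma coassoc_trilin U (F : H -> H -> H -> U) h : trilin F ->
  \tsum_(a, c <- Δ h) \tsum_(a1, a2 <- Δ a) F a1 a2 c
  = \tsum_(a, b <- Δ h) \tsum_(b1, b2 <- Δ b) F a b1 b2.
Proof.
move=> tF; pose G := tsum (fun (x : (H ⊗ H)%type) c => \tsum_(a, b <- x) F a b c).
have bG : bilin (fun (x : (H ⊗ H)%type) c => \tsum_(a, b <- x) F a b c) by lin.
have lG : linear G by exact: tsum_linear.
have := congr1 G (coassoc h); rewrite !linear_tsum //.
move=> e; transitivity (\tsum_(a, c <- Δ h) G (\tsum_(a1, a2 <- Δ a) a1 ⊗ a2 ⊗ c)).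
  apply: eq_tsum => a c; rewrite linear_tsum //; apply: eq_tsum => a1 a2.
  by rewrite /G !tsum_pure //; lin.
rewrite e; apply: eq_tsum => a c; rewrite linear_tsum //; apply: eq_tsum => a1 a2.
by rewrite /G !tsum_pure //; lin.
Qed.

Lemma counitl_lin U (f : H -> U) h : linear f ->
  \tsum_(h1, h2 <- Δ h) ε h1 *: f h2 = f h.
Proof.
move=> lf; rewrite -[in RHS](counitl h) linear_tsum //.
by apply: eq_tsum => a b; rewrite (scalable_linear lf).
Qed.

Lemma counitr_lin U (f : H -> U) h : linear f ->
  \tsum_(h1, h2 <- Δ h) ε h2 *: f h1 = f h.
Proof.
move=> lf; rewrite -[in RHS](counitr h) linear_tsum //.
by apply: eq_tsum => a b; rewrite (scalable_linear lf).
Qed.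

(* Convolution of (bi-, tri-)linear maps on H along a bilinear operation. *)
Definition conv1 U V W (op : U -> V -> W) (F : H -> U) (G : H -> V) h : W :=
  \tsum_(h1, h2 <- Δ h) op (F h1) (G h2).
Definition conv2 U V W (op : U -> V -> W) (F : H -> H -> U) (G : H -> H -> V)
    h g : W :=
  \tsum_(h1, h2 <- Δ h) \tsum_(g1, g2 <- Δ g) op (F h1 g1) (G h2 g2).
Definition conv3 U V W (op : U -> V -> W) (F : H -> H -> H -> U)
    (G : H -> H -> H -> V) h g l : W :=
  \tsum_(h1, h2 <- Δ h) \tsum_(g1, g2 <- Δ g) \tsum_(l1, l2 <- Δ l)
    op (F h1 g1 l1) (G h2 g2 l2).

Section Assoc1.
Variables (U V W X Y Z : lmodType k) (op : X -> W -> Z) (op' : U -> V -> X)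
  (op'' : U -> Y -> Z) (op''' : V -> W -> Y).
Hypotheses (bop : bilin op) (bop' : bilin op') (bop'' : bilin op'')
  (bop''' : bilin op''').
Hypothesis opA : forall u v w, op (op' u v) w = op'' u (op''' v w).

Lemma conv1A F G K h : linear F -> linear G -> linear K ->
  conv1 op (conv1 op' F G) K h = conv1 op'' F (conv1 op''' G K) h.
Proof.
move=> lF lG lK; rewrite /conv1.
transitivity (\tsum_(a, c <- Δ h) \tsum_(a1, a2 <- Δ a) op'' (F a1) (op''' (G a2) (K c))).
  apply: eq_tsum => a c; rewrite (linear_tsum (g := fun x => op x (K c))); last by lin.
  by apply: eq_tsum => a1 a2; rewrite opA.
rewrite (coassoc_trilin (F := fun a b c => op'' (F a) (op''' (G b) (K c)))).
  apply: eq_tsum => a c; rewrite (linear_tsum (g := op'' (F a))) //; by case: bop''.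
by split=> ? ?; repeat first [apply: lin_bl => // | apply: lin_br => //].
Qed.

End Assoc1.

Lemma trilin_tsum V W U (F : V -> W -> H -> H -> H -> U) (t : V ⊗ W) :
  (forall v w, trilin (F v w)) ->
  trilin (fun a b c => \tsum_(v, w <- t) F v w a b c).
Proof.
by move=> tF; split=> x y; apply: lin_tsum_body => v w; case: (tF v w) => *.
Qed.

Lemma coassoc_bi U (P : H -> H -> H -> H -> H -> H -> U) h g :
  (forall b1 b2 d, trilin (fun a1 a2 c => P a1 a2 c b1 b2 d)) ->
  (forall a1 a2 c, trilin (fun b1 b2 d => P a1 a2 c b1 b2 d)) ->
  \tsum_(a, c <- Δ h) \tsum_(b, d <- Δ g)
    \tsum_(a1, a2 <- Δ a) \tsum_(b1, b2 <- Δ b) P a1 a2 c b1 b2 d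
  = \tsum_(a1, a <- Δ h) \tsum_(b1, b <- Δ g)
    \tsum_(a2, c <- Δ a) \tsum_(b2, d <- Δ b) P a1 a2 c b1 b2 d.
Proof.
move=> tA tB.
pose Q a1 a2 c := \tsum_(b, d <- Δ g) \tsum_(b1, b2 <- Δ b) P a1 a2 c b1 b2 d.
transitivity (\tsum_(a, c <- Δ h) \tsum_(a1, a2 <- Δ a) Q a1 a2 c).
  by apply: eq_tsum => a c; rewrite tsum_exchange.
rewrite coassoc_trilin; last by do 2!apply: trilin_tsum => ? ?; exact: tA.
apply: eq_tsum => a1 a; rewrite [RHS]tsum_exchange.
by apply: eq_tsum => a2 c; exact: coassoc_trilin.
Qed.

Lemma coassoc_tri U (P : H -> H -> H -> H -> H -> H -> H -> H -> H -> U) h g l :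
  (forall b1 b2 d e1 e2 f, trilin (fun a1 a2 c => P a1 a2 c b1 b2 d e1 e2 f)) ->
  (forall a1 a2 c e1 e2 f, trilin (fun b1 b2 d => P a1 a2 c b1 b2 d e1 e2 f)) ->
  (forall a1 a2 c b1 b2 d, trilin (fun e1 e2 f => P a1 a2 c b1 b2 d e1 e2 f)) ->
  \tsum_(a, c <- Δ h) \tsum_(b, d <- Δ g) \tsum_(e, f <- Δ l)
    \tsum_(a1, a2 <- Δ a) \tsum_(b1, b2 <- Δ b) \tsum_(e1, e2 <- Δ e)
      P a1 a2 c b1 b2 d e1 e2 f
  = \tsum_(a1, a <- Δ h) \tsum_(b1, b <- Δ g) \tsum_(e1, e <- Δ l)
    \tsum_(a2, c <- Δ a) \tsum_(b2, d <- Δ b) \tsum_(e2, f <- Δ e)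
      P a1 a2 c b1 b2 d e1 e2 f.
Proof.
move=> tA tB tE.
pose Q a1 a2 c := \tsum_(b, d <- Δ g) \tsum_(e, f <- Δ l)
  \tsum_(b1, b2 <- Δ b) \tsum_(e1, e2 <- Δ e) P a1 a2 c b1 b2 d e1 e2 f.
transitivity (\tsum_(a, c <- Δ h) \tsum_(a1, a2 <- Δ a) Q a1 a2 c).
  apply: eq_tsum => a c; rewrite [RHS]tsum_exchange; apply: eq_tsum => b d.
  by rewrite [RHS]tsum_exchange.
rewrite coassoc_trilin; last by do 4!apply: trilin_tsum => ? ?; exact: tA.
apply: eq_tsum => a1 a; transitivity (\tsum_(a2, c <- Δ a) 
    \tsum_(b1, b <- Δ g) \tsum_(e1, e <- Δ l) \tsum_(b2, d <- Δ b)
    \tsum_(e2, f <- Δ e) P a1 a2 c b1 b2 d e1 e2 f).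
  by apply: eq_tsum => a2 c; exact: coassoc_bi.
rewrite tsum_exchange; apply: eq_tsum => b1 b.
by rewrite tsum_exchange.
Qed.

Section Assoc23.
Variables (U V W X Y Z : lmodType k) (op : X -> W -> Z) (op' : U -> V -> X)
  (op'' : U -> Y -> Z) (op''' : V -> W -> Y).
Hypotheses (bop : bilin op) (bop' : bilin op') (bop'' : bilin op'')
  (bop''' : bilin op''').
Hypothesis opA : forall u v w, op (op' u v) w = op'' u (op''' v w).

Lemma conv2A F G K h g : bilin F -> bilin G -> bilin K ->
  conv2 op (conv2 op' F G) K h g = conv2 op'' F (conv2 op''' G K) h g.
Proof.
move=> bF bG bK; rewrite /conv2.
under eq_tsum => a c do under eq_tsum => b d do
  (rewrite (linear_tsum (g := fun x => op x (K c d))); last (by lin);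
   under eq_tsum => a1 a2 do
   (rewrite (linear_tsum (g := fun x => op x (K c d))); last (by lin);
   under eq_tsum => b1 b2 do rewrite opA)).
rewrite (coassoc_bi (P := fun a1 a2 c b1 b2 d =>
  op'' (F a1 b1) (op''' (G a2 b2) (K c d)))).
- apply: eq_tsum => a c; apply: eq_tsum => b d.
  rewrite (linear_tsum (g := op'' (F a b))); last by case: bop''.
  apply: eq_tsum => a2 e; rewrite (linear_tsum (g := op'' (F a b))) //.
  by case: bop''.
- by move=> *; split=> * /=; lin.
- by move=> *; split=> * /=; lin.
Qed.

Lemma conv3A F G K h g l : trilin F -> trilin G -> trilin K ->
  conv3 op (conv3 op' F G) K h g l = conv3 op'' F (conv3 op''' G K) h g l.
Proof.
move=> tF tG tK; rewrite /conv3.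
under eq_tsum => a c do under eq_tsum => b d do under eq_tsum => e f do
  (rewrite (linear_tsum (g := fun x => op x (K c d f))); last (by lin);
   under eq_tsum => a1 a2 do
   (rewrite (linear_tsum (g := fun x => op x (K c d f))); last (by lin);
   under eq_tsum => b1 b2 do
   (rewrite (linear_tsum (g := fun x => op x (K c d f))); last (by lin);
   under eq_tsum => e1 e2 do rewrite opA))).
rewrite (coassoc_tri (P := fun a1 a2 c b1 b2 d e1 e2 f =>
  op'' (F a1 b1 e1) (op''' (G a2 b2 e2) (K c d f)))).
- have lop u : linear (op'' u) by case: bop''.
  apply: eq_tsum => a c; apply: eq_tsum => b d; apply: eq_tsum => e f.
  rewrite (linear_tsum (g := op'' (F a b e))) //; apply: eq_tsum => a2 a3.
  rewrite (linear_tsum (g := op'' (F a b e))) //; apply: eq_tsum => b2 b3.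
  by rewrite (linear_tsum (g := op'' (F a b e))).
- by move=> *; split=> * /=; lin.
- by move=> *; split=> * /=; lin.
- by move=> *; split=> * /=; lin.
Qed.

End Assoc23.
End Convolution.

Lemma tsum_tsum (k : fieldType) (V W V' W' U : lmodType k)
    (F : V -> W -> U) (G : V' -> W' -> V ⊗ W) t : bilin F ->
  tsum F (tsum G t) = \tsum_(v, w <- t) tsum F (G v w).
Proof. by move=> bF; rewrite linear_tsum //; exact: tsum_linear. Qed.

Lemma eq_tensor2 (k : fieldType) (V W V' W' U : lmodType k)
    (F G : V ⊗ W -> V' ⊗ W' -> U) : bilin F -> bilin G ->
  (forall v w v' w', F (v ⊗ w) (v' ⊗ w') = G (v ⊗ w) (v' ⊗ w')) ->
  forall x y, F x y = G x y.
Proof.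
move=> [Fl Fr] [Gl Gr] e x y.
apply: (tensor_ext (f := F^~ y) (g := G^~ y)) => // v w.
by apply: (tensor_ext (Fr _) (Gr _)) => v' w'.
Qed.

Section CrossedProduct.
Variables (k : fieldType) (H : coquasi_bialgebra k) (R : algebra k)
  (S : crossed_system H R).

Local Notation "r ∗ s" := (amul r s) (at level 40, left associativity).
Local Notation "h ▷ r" := (act S h r) (at level 35, right associativity).
Local Notation "h ⋆ g" := (cmul h g) (at level 40, left associativity).
Local Notation σ := (sigma S).

Definition cp_mul (x y : R ⊗ H) : R ⊗ H :=
  \tsum_(r, h <- x) \tsum_(s, g <- y)
  \tsum_(h1, h' <- Δ h) \tsum_(h2, h3 <- Δ h') \tsum_(g1, g2 <- Δ g)
    (r ∗ (h1 ▷ s) ∗ σ h2 g1) ⊗ (h3 ⋆ g2).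

Definition cp_one : R ⊗ H := aone ⊗ cone.

Definition cp_coact (x : R ⊗ H) : R ⊗ H ⊗ H :=
  \tsum_(r, h <- x) \tsum_(h1, h2 <- Δ h) r ⊗ h1 ⊗ h2.

Lemma cp_mul_bilin : bilin cp_mul.
Proof. rewrite /cp_mul; lin. Qed.

Lemma cp_coact_linear : linear cp_coact.
Proof. rewrite /cp_coact; lin. Qed.

Lemma cp_coact_pure r h :
  cp_coact (r ⊗ h) = \tsum_(h1, h2 <- Δ h) r ⊗ h1 ⊗ h2.
Proof. by rewrite /cp_coact tsum_pure //; lin. Qed.

HB.instance Definition _ := GRing.isLinear.Build _ _ _ _ _ cp_coact_linear.

Lemma cp_coact_coassoc x :
  \tsum_(x0, x1 <- cp_coact x) \tsum_(x00, x01 <- cp_coact x0) x00 ⊗ x01 ⊗ x1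
  = \tsum_(x0, x1 <- cp_coact x) \tsum_(h1, h2 <- Δ x1) x0 ⊗ h1 ⊗ h2.
Proof.
have lc := cp_coact_linear.
pose f x := \tsum_(x0, x1 <- cp_coact x) \tsum_(x00, x01 <- cp_coact x0)
  x00 ⊗ x01 ⊗ x1.
pose g x := \tsum_(x0, x1 <- cp_coact x) \tsum_(h1, h2 <- Δ x1) x0 ⊗ h1 ⊗ h2.
apply: (tensor_ext (f := f) (g := g)); rewrite /f /g; [lin | lin |].
move=> r h; rewrite cp_coact_pure !tsum_tsum; [|lin|lin].
under eq_tsum => h1 h2 do
  (rewrite tsum_pure; last (by lin); rewrite cp_coact_pure tsum_tsum; last (by lin);
   under eq_tsum => a b do (rewrite tsum_pure; last by lin)).
rewrite (coassoc_trilin (F := fun a b c => r ⊗ a ⊗ b ⊗ c)); last by lin.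
apply: eq_tsum => h1 h2; rewrite tsum_pure //; lin.
Qed.

Lemma cp_coact_counit x : \tsum_(x0, x1 <- cp_coact x) ε x1 *: x0 = x.
Proof.
pose f x := \tsum_(x0, x1 <- cp_coact x) ε x1 *: x0.
have lc := cp_coact_linear.
apply: (tensor_ext (f := f) (g := id)); rewrite /f; [lin | exact: lin_id |].
move=> r h; rewrite cp_coact_pure tsum_tsum; last by lin.
under eq_tsum => h1 h2 do (rewrite tsum_pure; last by lin).
by rewrite (counitr_lin (f := fun h => r ⊗ h)) //; lin.
Qed.

Definition cp_comodule : comodule H :=
  @Comodule k H (R ⊗ H)%type cp_coact cp_coact_coassoc cp_coact_counit.

(* For the quasi-associativity of cp_mul: lact is left multiplication by R;   *)
(* cp_Y h g = (1 ⊗ h)(1 ⊗ g), so that both sides reduce to multiples of       *)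
(* cp_V h g l = ((1 ⊗ h)(1 ⊗ g))(1 ⊗ l) and of                                *)
(* cp_U h g l = (1 ⊗ h)((1 ⊗ g)(1 ⊗ l)), which cp_VU compares.                *)
Definition lact (r : R) (x : R ⊗ H) : R ⊗ H := \tsum_(s, h <- x) (r ∗ s) ⊗ h.

Lemma lact_bilin : bilin lact.
Proof. rewrite /lact; lin. Qed.

Lemma lact_pure r s h : lact r (s ⊗ h) = (r ∗ s) ⊗ h.
Proof. rewrite /lact tsum_pure //; lin. Qed.

Lemma lactA r s x : lact (r ∗ s) x = lact r (lact s x).
Proof.
have bl := lact_bilin.
apply: (tensor_ext (f := lact (r ∗ s)) (g := fun x => lact r (lact s x))).
- lin.
- by apply: lin_br; [|apply: lin_bilr].
- by move=> t h; rewrite !lact_pure amulA.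
Qed.

Definition cp_Y h g : R ⊗ H :=
  \tsum_(h1, h2 <- Δ h) \tsum_(g1, g2 <- Δ g) σ h1 g1 ⊗ (h2 ⋆ g2).

Lemma cp_Y_bilin : bilin cp_Y.
Proof. rewrite /cp_Y; lin. Qed.

Definition cp_phi h (x : R ⊗ H) : R ⊗ H :=
  \tsum_(s, g <- x) \tsum_(h1, h2 <- Δ h) lact (h1 ▷ s) (cp_Y h2 g).

Lemma cp_phi_bilin : bilin cp_phi.
Proof. have bl := lact_bilin; have bY := cp_Y_bilin; rewrite /cp_phi; lin. Qed.

Lemma cp_phi_pure h s g :
  cp_phi h (s ⊗ g) = \tsum_(h1, h2 <- Δ h) lact (h1 ▷ s) (cp_Y h2 g).
Proof.
have bl := lact_bilin; have bY := cp_Y_bilin.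
by rewrite /cp_phi tsum_pure //; lin.
Qed.

Lemma cp_mul_phi r h y : cp_mul (r ⊗ h) y = lact r (cp_phi h y).
Proof.
have bl := lact_bilin; have bY := cp_Y_bilin; have bp := cp_phi_bilin.
have bm := cp_mul_bilin.
apply: (tensor_ext (f := cp_mul (r ⊗ h)) (g := fun x => lact r (cp_phi h x))).
- lin.
- by apply: lin_br; [|apply: lin_bilr].
move=> s g; rewrite /cp_mul !tsum_pure; [|lin|lin].
rewrite cp_phi_pure (linear_tsum (g := lact r)); last by lin.
apply: eq_tsum => h1 h'; rewrite -lactA /cp_Y (linear_tsum (g := lact _)); last by lin.
apply: eq_tsum => h2 h3; rewrite (linear_tsum (g := lact _)); last by lin.
by apply: eq_tsum => g1 g2; rewrite lact_pure.
Qed.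

Lemma cp_mul_lact r x y : cp_mul (lact r x) y = lact r (cp_mul x y).
Proof.
have bl := lact_bilin; have bm := cp_mul_bilin.
apply: (tensor_ext (f := fun x => cp_mul (lact r x) y)
                   (g := fun x => lact r (cp_mul x y))).
- by apply: lin_bl; [|apply: lin_bilr].
- by apply: lin_br; [|lin].
by move=> s h; rewrite lact_pure !cp_mul_phi lactA.
Qed.

Lemma cp_phi_lact h s x :
  cp_phi h (lact s x) = conv1 lact (fun h => h ▷ s) (fun h => cp_phi h x) h.
Proof.
have bl := lact_bilin; have bp := cp_phi_bilin; have bY := cp_Y_bilin.
apply: (tensor_ext (f := fun x => cp_phi h (lact s x))
   (g := fun x => conv1 lact (fun h => h ▷ s) (fun h => cp_phi h x) h)).
- by apply: lin_br; [|apply: lin_bilr].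
- by rewrite /conv1; lin.
move=> t g; rewrite lact_pure cp_phi_pure.
transitivity (conv1 lact (conv1 amul (fun h => h ▷ s) (fun h => h ▷ t))
   (fun h => cp_Y h g) h).
  by apply: eq_tsum => h1 h2; rewrite act_mul.
rewrite (conv1A (op'' := lact) (op''' := lact)) //; try lin; last exact: lactA.
by apply: eq_tsum => h1 h2; rewrite cp_phi_pure.
Qed.

Lemma cp_mul1x : left_id cp_one cp_mul.
Proof.
have bl := lact_bilin; have bp := cp_phi_bilin; have bY := cp_Y_bilin.
have bm := cp_mul_bilin.
move=> x; apply: (tensor_ext (f := cp_mul cp_one) (g := id)); [lin|exact: lin_id|].
move=> r h; rewrite cp_mul_phi cp_phi_pure Delta_one tsum_pure; last by lin.
rewrite /cp_Y Delta_one tsum_pure; last by lin.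
under eq_tsum => h1 h2 do rewrite sigma_1h cmul1h.
rewrite -lactA one_act amul1r (linear_tsum (g := lact r)); last by lin.
transitivity (\tsum_(h1, h2 <- Δ h) ε h1 *: (r ⊗ h2)).
  apply: eq_tsum => h1 h2; rewrite lact_pure.
  by rewrite (scalable_linear ((amul_bilin R).2 r)) amulr1
    (scalable_linear ((pure_bilin R H).1 h2)).
by rewrite (counitl_lin (f := fun h => r ⊗ h)) //; lin.
Qed.

Lemma cp_mulx1 : right_id cp_one cp_mul.
Proof.
have bl := lact_bilin; have bp := cp_phi_bilin; have bY := cp_Y_bilin.
have bm := cp_mul_bilin.
move=> x; apply: (tensor_ext (f := cp_mul^~ cp_one) (g := id)); [lin|exact: lin_id|].
move=> r h; rewrite cp_mul_phi cp_phi_pure.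
have Y1 g : cp_Y g cone = aone ⊗ g.
  rewrite /cp_Y; transitivity (\tsum_(h1, h2 <- Δ g) ε h1 *: ((aone : R) ⊗ h2)).
    apply: eq_tsum => h1 h2; rewrite Delta_one tsum_pure; last by lin.
    by rewrite sigma_h1 cmulh1 (scalable_linear ((pure_bilin R H).1 h2)).
  by rewrite (counitl_lin (f := fun h => aone ⊗ h)) //; lin.
transitivity (lact r (\tsum_(h1, h2 <- Δ h) ε h1 *: ((aone : R) ⊗ h2))).
  congr lact; apply: eq_tsum => h1 h2; rewrite act_one Y1.
  by rewrite (scalable_linear (bl.1 _)) lact_pure amul1r.
rewrite (counitl_lin (f := fun h => aone ⊗ h)) //; last by lin.
by rewrite lact_pure amulr1.
Qed.

Lemma cp_coact_lact r x :
  cp_coact (lact r x) = \tsum_(x0, x1 <- cp_coact x) lact r x0 ⊗ x1.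
Proof.
have bl := lact_bilin; have lc := cp_coact_linear.
apply: (tensor_ext (f := fun x => cp_coact (lact r x))
  (g := fun x => \tsum_(x0, x1 <- cp_coact x) lact r x0 ⊗ x1)).
- by apply: lin_comp; [|apply: lin_bilr].
- lin.
move=> s h; rewrite lact_pure !cp_coact_pure tsum_tsum; last by lin.
by apply: eq_tsum => h1 h2; rewrite tsum_pure; [rewrite lact_pure | lin].
Qed.

Lemma cp_coact_Y h g :
  cp_coact (cp_Y h g) = conv2 pure cp_Y (fun h g => h ⋆ g) h g.
Proof.
have bl := lact_bilin; have lc := cp_coact_linear; have bY := cp_Y_bilin.
rewrite (linear_tsum (g := cp_coact)) //.
transitivity (conv2 (fun r (x : H ⊗ H) => \tsum_(a, b <- x) r ⊗ a ⊗ b) σ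
   (conv2 pure (fun h g => h ⋆ g) (fun h g => h ⋆ g)) h g).
  apply: eq_tsum => h1 h2; rewrite (linear_tsum (g := cp_coact)) //.
  by apply: eq_tsum => g1 g2; rewrite cp_coact_pure Delta_mul.
rewrite -(conv2A (op := pure) (op' := pure)) //; try by lin.
by move=> u v w; rewrite tsum_pure //; lin.
Qed.

Lemma cp_coact_mul x y :
  cp_coact (cp_mul x y)
  = \tsum_(x0, x1 <- cp_coact x) \tsum_(y0, y1 <- cp_coact y)
      cp_mul x0 y0 ⊗ (x1 ⋆ y1).
Proof.
have bl := lact_bilin; have bp := cp_phi_bilin; have bY := cp_Y_bilin.
have bm := cp_mul_bilin; have lc := cp_coact_linear.
move: x y; apply: eq_tensor2.
- by split=> ?; apply: lin_comp => //; lin.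
- lin.
move=> r h s g; rewrite !cp_coact_pure tsum_tsum; last by lin.
rewrite cp_mul_phi cp_coact_lact cp_phi_pure (linear_tsum (g := cp_coact)) //.
rewrite tsum_tsum; last by lin.
transitivity (\tsum_(h1, h2 <- Δ h) \tsum_(a, b <- Δ h2) \tsum_(g1, g2 <- Δ g)
   lact r (lact (h1 ▷ s) (cp_Y a g1)) ⊗ (b ⋆ g2)).
  apply: eq_tsum => h1 h2; rewrite cp_coact_lact cp_coact_Y tsum_tsum; last by lin.
  rewrite /conv2 tsum_tsum; last by lin.
  apply: eq_tsum => a b; rewrite tsum_tsum; last by lin.
  by apply: eq_tsum => c d; rewrite tsum_pure ?tsum_pure //; lin.
rewrite -(coassoc_trilin (F := fun h1 a b => \tsum_(g1, g2 <- Δ g)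
   lact r (lact (h1 ▷ s) (cp_Y a g1)) ⊗ (b ⋆ g2))); last by lin.
apply: eq_tsum => h1 h2; rewrite tsum_pure; last by lin.
rewrite tsum_tsum; last by lin.
rewrite tsum_exchange; apply: eq_tsum => g1 g2; rewrite tsum_pure; last by lin.
rewrite cp_mul_phi cp_phi_pure (linear_tsum (g := lact r)); last by lin.
by rewrite (linear_tsum (g := pure^~ (h2 ⋆ g2))); last by lin.
Qed.

Lemma cp_coact_one : cp_coact cp_one = cp_one ⊗ cone.
Proof. by rewrite cp_coact_pure Delta_one tsum_pure //; lin. Qed.

Lemma form_trilin (V : lmodType k) (f : V -> V -> V -> k) :
  trilin_form f -> trilin (f : V -> V -> V -> k^o).
Proof. by move=> [h1 h2 h3]; split=> x y; [exact: h1|exact: h2|exact: h3]. Qed.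

Lemma scalel_bilin (V : lmodType k) : bilin (fun (a : k^o) (v : V) => a *: v).
Proof.
by split=> x a u v; rewrite ?scalerDl ?scalerDr !scalerA // mulrC.
Qed.

Lemma scaler_bilin (V : lmodType k) : bilin (fun (v : V) (a : k^o) => a *: v).
Proof. by case: (scalel_bilin V). Qed.

Local Notation rscale := (fun v (a : k^o) => a *: v).
Local Notation lscale := (fun (a : k^o) v => a *: v).
Local Notation omg := (omega : H -> H -> H -> k^o).
Local Notation omgi := (omega_inv : H -> H -> H -> k^o).

Lemma kmul_bilin : bilin (fun a b : k^o => a * b : k^o).
Proof.
split=> x a u v; first by rewrite mulrDl -[a *: u]/(a * u) -mulrA.
by rewrite mulrDr -[a *: u]/(a * u) mulrCA.
Qed.

Lemma cmul_quasi_assoc_inv h g l :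
  conv3 lscale omgi (conv3 rscale (fun h g l => h ⋆ (g ⋆ l)) omg) h g l
  = h ⋆ g ⋆ l.
Proof.
have tw := form_trilin (omega_trilin H); have twi := form_trilin (omega_inv_trilin H).
have bsl := scalel_bilin H; have bsr := scaler_bilin H; have bk := kmul_bilin.
transitivity (conv3 lscale omgi
  (conv3 lscale omg (fun h g l => h ⋆ g ⋆ l)) h g l).
  apply: eq_tsum => h1 h2; apply: eq_tsum => g1 g2; apply: eq_tsum => l1 l2.
  by congr (_ *: _); exact: cmul_quasi_assoc.
rewrite -(conv3A (op := lscale) (op' := fun a b : k^o => a * b : k^o)) //.
- transitivity (\tsum_(h1, h2 <- Δ h) \tsum_(g1, g2 <- Δ g) \tsum_(l1, l2 <- Δ l)
      (ε h1 * ε g1 * ε l1) *: (h2 ⋆ g2 ⋆ l2)).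
    apply: eq_tsum => h1 h2; apply: eq_tsum => g1 g2; apply: eq_tsum => l1 l2.
    by congr (_ *: _); exact: omega_inv_omega.
  transitivity (\tsum_(h1, h2 <- Δ h) ε h1 *: (h2 ⋆ g ⋆ l)); last first.
    by rewrite (counitl_lin (f := fun h => h ⋆ g ⋆ l)) //; lin.
  apply: eq_tsum => h1 h2.
  rewrite -(counitl_lin (f := fun g => h2 ⋆ g ⋆ l)); last by lin.
  rewrite (linear_tsum (g := fun x => ε h1 *: x)); last by lin.
  apply: eq_tsum => g1 g2.
  rewrite -(counitl_lin (f := fun l => h2 ⋆ g2 ⋆ l)); last by lin.
  rewrite scalerA (linear_tsum (g := fun x => _ *: x)); last by lin.
  by apply: eq_tsum => l1 l2; rewrite scalerA.
- by move=> a b v; rewrite scalerA.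
- by lin.
Qed.

Definition cp_kappa h g l : R :=
  conv3 amul (fun h g l => h ▷ σ g l) (fun h g l => σ h (g ⋆ l)) h g l.
Definition cp_tau h g l : R :=
  \tsum_(h1, h2 <- Δ h) \tsum_(g1, g2 <- Δ g) σ h1 g1 ∗ σ (h2 ⋆ g2) l.

Lemma cp_kappa_trilin : trilin cp_kappa.
Proof. by rewrite /cp_kappa /conv3; lin. Qed.

Lemma cp_tau_trilin : trilin cp_tau.
Proof. by rewrite /cp_tau; lin. Qed.

Lemma cp_kappaE h g l : cp_kappa h g l = conv3 rscale cp_tau omgi h g l.
Proof.
have [o1 o2 o3] := form_trilin (omega_inv_trilin H); have bs := scaler_bilin R.
rewrite /cp_kappa /conv3 sigma_cocycle.
transitivity (\tsum_(h1, h' <- Δ h) \tsum_(g1, g' <- Δ g)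
   \tsum_(h2, h3 <- Δ h') \tsum_(g2, g3 <- Δ g') \tsum_(l1, l2 <- Δ l)
     omega_inv h3 g3 l2 *: (σ h1 g1 ∗ σ (h2 ⋆ g2) l1)).
  by apply: eq_tsum => h1 h'; rewrite tsum_exchange.
rewrite -(coassoc_bi (P := fun h1 h2 h3 g1 g2 g3 => \tsum_(l1, l2 <- Δ l)
     omega_inv h3 g3 l2 *: (σ h1 g1 ∗ σ (h2 ⋆ g2) l1))); last 2 first.
- by move=> *; lin.
- by move=> *; lin.
apply: eq_tsum => a c; apply: eq_tsum => b d.
under eq_tsum => a1 a2 do rewrite tsum_exchange.
rewrite tsum_exchange; apply: eq_tsum => l1 l2; rewrite /cp_tau /=.
rewrite (linear_tsum (g := fun x : R => omega_inv c d l2 *: x)); last by lin.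
apply: eq_tsum => a1 a2.
by rewrite (linear_tsum (g := fun x : R => omega_inv c d l2 *: x)); last by lin.
Qed.

Definition cp_V h g l := conv2 lact σ (fun h g => cp_Y (h ⋆ g) l) h g.
Definition cp_U h g l := cp_phi h (cp_Y g l).

Lemma cp_U_trilin : trilin cp_U.
Proof.
have bp := cp_phi_bilin; have bY := cp_Y_bilin.
by rewrite /cp_U; split=> ? ?;
  [apply: lin_bl; [|lin]|apply: lin_br; [|lin]|apply: lin_br; [|lin]].
Qed.

Lemma cp_V_conv h g l :
  cp_V h g l = conv3 pure cp_tau (fun h g l => h ⋆ g ⋆ l) h g l.
Proof.
have bl := lact_bilin; have bp := cp_phi_bilin; have bY := cp_Y_bilin.
rewrite /cp_V /conv2.
transitivity (\tsum_(h1, h' <- Δ h) \tsum_(g1, g' <- Δ g)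
   \tsum_(h2, h3 <- Δ h') \tsum_(g2, g3 <- Δ g') \tsum_(l1, l2 <- Δ l)
     (σ h1 g1 ∗ σ (h2 ⋆ g2) l1) ⊗ (h3 ⋆ g3 ⋆ l2)).
  apply: eq_tsum => h1 h'; apply: eq_tsum => g1 g'.
  rewrite /cp_Y Delta_mul tsum_tsum; last by lin.
  rewrite (linear_tsum (g := lact _)); last by lin.
  apply: eq_tsum => h2 h3; rewrite tsum_tsum; last by lin.
  rewrite (linear_tsum (g := lact _)); last by lin.
  apply: eq_tsum => g2 g3; rewrite tsum_pure; last by lin.
  rewrite (linear_tsum (g := lact _)); last by lin.
  by apply: eq_tsum => l1 l2; rewrite lact_pure.
rewrite -(coassoc_bi (P := fun h1 h2 h3 g1 g2 g3 => \tsum_(l1, l2 <- Δ l)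
     (σ h1 g1 ∗ σ (h2 ⋆ g2) l1) ⊗ (h3 ⋆ g3 ⋆ l2))); last 2 first.
- by move=> *; lin.
- by move=> *; lin.
apply: eq_tsum => a c; apply: eq_tsum => b d.
under eq_tsum => a1 a2 do rewrite tsum_exchange.
rewrite tsum_exchange; apply: eq_tsum => l1 l2; rewrite /cp_tau.
rewrite (linear_tsum (g := fun x => x ⊗ _)); last by lin.
apply: eq_tsum => a1 a2.
by rewrite (linear_tsum (g := fun x => x ⊗ _)); last by lin.
Qed.

Lemma cp_U_conv h g l :
  cp_U h g l = conv3 pure cp_kappa (fun h g l => h ⋆ (g ⋆ l)) h g l.
Proof.
have bl := lact_bilin; have bp := cp_phi_bilin; have bY := cp_Y_bilin.
transitivity (conv3 lact (fun h g l => h ▷ σ g l)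
   (conv3 pure (fun h g l => σ h (g ⋆ l)) (fun h g l => h ⋆ (g ⋆ l))) h g l).
  rewrite /cp_U /cp_Y (linear_tsum (g := cp_phi h)); last by lin.
  transitivity (\tsum_(g1, g2 <- Δ g) \tsum_(h1, h2 <- Δ h) \tsum_(l1, l2 <- Δ l)
     lact (h1 ▷ σ g1 l1) (cp_Y h2 (g2 ⋆ l2))).
    apply: eq_tsum => g1 g2; rewrite (linear_tsum (g := cp_phi h)); last by lin.
    rewrite [RHS]tsum_exchange; apply: eq_tsum => l1 l2.
    by rewrite cp_phi_pure.
  rewrite tsum_exchange; apply: eq_tsum => h1 h2; apply: eq_tsum => g1 g2.
  apply: eq_tsum => l1 l2; congr lact; rewrite /cp_Y /conv3.
  apply: eq_tsum => a b; rewrite Delta_mul tsum_tsum; last by lin.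
  apply: eq_tsum => c d; rewrite tsum_tsum; last by lin.
  by apply: eq_tsum => e f; rewrite tsum_pure //; lin.
rewrite -(conv3A (op := pure) (op' := amul)) //; try by lin.
by move=> u v w; rewrite lact_pure.
Qed.

Lemma cp_VU h g l : cp_V h g l = conv3 rscale cp_U omg h g l.
Proof.
have tw := form_trilin (omega_trilin H); have twi := form_trilin (omega_inv_trilin H).
have bsl := scalel_bilin H; have bsr := scaler_bilin H; have bk := kmul_bilin.
have bsR := scaler_bilin R; have bsRH := scaler_bilin (R ⊗ H)%type.
have tk := cp_kappa_trilin; have tt := cp_tau_trilin.
have pr := pure_bilin R H.
rewrite cp_V_conv.
transitivity (conv3 pure cp_tau (conv3 lscale omgi
  (conv3 rscale (fun h g l => h ⋆ (g ⋆ l)) omg)) h g l).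
  apply: eq_tsum => h1 h2; apply: eq_tsum => g1 g2; apply: eq_tsum => l1 l2.
  by congr (_ ⊗ _); rewrite cmul_quasi_assoc_inv.
have tM : trilin (fun h g l : H => h ⋆ (g ⋆ l)) by lin.
have tMo : trilin (conv3 rscale (fun h g l : H => h ⋆ (g ⋆ l)) omg).
  by rewrite /conv3; lin.
rewrite -(conv3A (op := pure) (op' := rscale)) //; last first.
  move=> u a v; rewrite (scalable_linear (pr.1 v)).
  by rewrite (scalable_linear (pr.2 u)).
transitivity (conv3 pure cp_kappa
  (conv3 rscale (fun h g l => h ⋆ (g ⋆ l)) omg) h g l).
  apply: eq_tsum => h1 h2; apply: eq_tsum => g1 g2; apply: eq_tsum => l1 l2.
  by rewrite cp_kappaE.
rewrite -(conv3A (op := rscale) (op' := pure)) //; last first.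
  by move=> u v a; rewrite (scalable_linear (pr.2 u)).
apply: eq_tsum => h1 h2; apply: eq_tsum => g1 g2; apply: eq_tsum => l1 l2.
by rewrite cp_U_conv.
Qed.

Lemma cp_mulYt h g t l :
  cp_mul (cp_Y h g) (t ⊗ l)
  = conv2 lact (fun h g => h ▷ g ▷ t) (fun h g => cp_V h g l) h g.
Proof.
have bl := lact_bilin; have bp := cp_phi_bilin; have bY := cp_Y_bilin.
have bm := cp_mul_bilin.
rewrite (linear_tsum (g := cp_mul^~ (t ⊗ l))); last by lin.
transitivity (conv2 lact σ (conv2 lact (fun h g => (h ⋆ g) ▷ t)
   (fun h g => cp_Y (h ⋆ g) l)) h g).
  apply: eq_tsum => h1 h2; rewrite (linear_tsum (g := cp_mul^~ _)); last by lin.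
  apply: eq_tsum => g1 g2; rewrite cp_mul_phi cp_phi_pure; congr lact.
  rewrite Delta_mul tsum_tsum; last by lin.
  apply: eq_tsum => a b; rewrite tsum_tsum; last by lin.
  by apply: eq_tsum => c d; rewrite tsum_pure //; lin.
rewrite -(conv2A (op := lact) (op' := amul)) //; try lin; last exact: lactA.
transitivity (conv2 lact (conv2 amul (fun h g => h ▷ g ▷ t) σ)
   (fun h g => cp_Y (h ⋆ g) l) h g).
  apply: eq_tsum => h1 h2; apply: eq_tsum => g1 g2; congr lact.
  by rewrite /conv2 act_sigma.
rewrite (conv2A (op'' := lact) (op''' := lact)) //; try lin.
exact: lactA.
Qed.

Lemma cp_mul_quasi_assoc x y z :
  cp_mul (cp_mul x y) z
  = \tsum_(x0, x1 <- cp_coact x) \tsum_(y0, y1 <- cp_coact y)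
    \tsum_(z0, z1 <- cp_coact z)
      omega x1 y1 z1 *: cp_mul x0 (cp_mul y0 z0).
Proof.
have bl := lact_bilin; have bp := cp_phi_bilin; have bY := cp_Y_bilin.
have bm := cp_mul_bilin; have lc := cp_coact_linear.
have tU := cp_U_trilin.
pose F x y z := \tsum_(x0, x1 <- cp_coact x) \tsum_(y0, y1 <- cp_coact y)
    \tsum_(z0, z1 <- cp_coact z) omega x1 y1 z1 *: cp_mul x0 (cp_mul y0 z0).
have bF3 x0 y0 : linear (F x0 y0) by rewrite /F; lin.
have bF12 z0 : bilin (fun x y => F x y z0) by rewrite /F; lin.
move: x y; apply: eq_tensor2; first by split=> ?; lin.
  exact: bF12.
move=> r h s g.
apply: (tensor_ext (f := cp_mul _) (g := F _ _)); first by lin.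
  exact: bF3.
move=> t l; rewrite /F !cp_coact_pure {F bF3 bF12}.
have bT : bilin (fun h g => h ▷ g ▷ t) by lin.
transitivity (lact r (\tsum_(h1, h2 <- Δ h) lact (h1 ▷ s)
   (conv2 lact (fun h g => h ▷ g ▷ t) (fun h g => cp_V h g l) h2 g))).
  rewrite cp_mul_phi cp_phi_pure cp_mul_lact; congr lact.
  rewrite (linear_tsum (g := cp_mul^~ (t ⊗ l))); last by lin.
  by apply: eq_tsum => h1 h2; rewrite cp_mul_lact cp_mulYt.
have triple h1 g1 l1 : cp_mul (r ⊗ h1) (cp_mul (s ⊗ g1) (t ⊗ l1))
   = \tsum_(a, b <- Δ h1) \tsum_(b1, b2 <- Δ b) \tsum_(c1, c2 <- Δ g1)
       lact r (lact (a ▷ s) (lact (b1 ▷ c1 ▷ t) (cp_U b2 c2 l1))).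
  rewrite !cp_mul_phi cp_phi_lact /conv1 (linear_tsum (g := lact r)); last by lin.
  apply: eq_tsum => a b; rewrite cp_phi_pure.
  rewrite (linear_tsum (g := cp_phi b)); last by lin.
  do 2 (rewrite (linear_tsum (g := lact _)); last by lin).
  rewrite [RHS]tsum_exchange; apply: eq_tsum => c1 c2.
  rewrite cp_phi_lact /conv1.
  by do 2 (rewrite (linear_tsum (g := lact _)); last by lin).
pose Q a b1 b2 h2 c1 c2 g2 := \tsum_(l1, l2 <- Δ l) omega h2 g2 l2 *:
  lact r (lact (a ▷ s) (lact (b1 ▷ c1 ▷ t) (cp_U b2 c2 l1))).
transitivity (\tsum_(h1, h2 <- Δ h) \tsum_(a, b <- Δ h1) \tsum_(g1, g2 <- Δ g)
   \tsum_(b1, b2 <- Δ b) \tsum_(c1, c2 <- Δ g1) Q a b1 b2 h2 c1 c2 g2); last first.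
  rewrite tsum_tsum; last by lin.
  apply: eq_tsum => h1 h2; rewrite tsum_pure; last by lin.
  rewrite tsum_tsum; last by lin.
  rewrite tsum_exchange; apply: eq_tsum => g1 g2; rewrite tsum_pure; last by lin.
  rewrite tsum_tsum; last by lin.
  under [RHS]eq_tsum => l1 l2 do (rewrite tsum_pure; last (by lin); rewrite triple).
  under [RHS]eq_tsum => l1 l2 do
    (rewrite (linear_tsum (g := fun x => _ *: x)); last (by lin)).
  rewrite [RHS]tsum_exchange; apply: eq_tsum => a b.
  under [RHS]eq_tsum => l1 l2 do
    (rewrite (linear_tsum (g := fun x => _ *: x)); last (by lin)).
  rewrite [RHS]tsum_exchange; apply: eq_tsum => b1 b2.
  under [RHS]eq_tsum => l1 l2 do
    (rewrite (linear_tsum (g := fun x => _ *: x)); last (by lin)).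
  by rewrite [RHS]tsum_exchange.
rewrite (coassoc_trilin (F := fun a b h2 => \tsum_(g1, g2 <- Δ g)
   \tsum_(b1, b2 <- Δ b) \tsum_(c1, c2 <- Δ g1) Q a b1 b2 h2 c1 c2 g2)); last first.
  by rewrite /Q; lin.
rewrite (linear_tsum (g := lact r)); last by lin.
apply: eq_tsum => a x.
transitivity (\tsum_(b1, b <- Δ x) \tsum_(c1, c <- Δ g)
   \tsum_(b2, h2 <- Δ b) \tsum_(c2, g2 <- Δ c) Q a b1 b2 h2 c1 c2 g2); last first.
  by rewrite coassoc_bi // /Q => *; lin.
rewrite /conv2.
do 2 (rewrite (linear_tsum (g := lact _)); last by lin).
apply: eq_tsum => b1 b; do 2 (rewrite (linear_tsum (g := lact _)); last by lin).
apply: eq_tsum => c1 c; rewrite cp_VU /conv3.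
do 3 (rewrite (linear_tsum (g := lact _)); last by lin).
apply: eq_tsum => b2 h2; do 3 (rewrite (linear_tsum (g := lact _)); last by lin).
apply: eq_tsum => c2 g2; do 3 (rewrite (linear_tsum (g := lact _)); last by lin).
apply: eq_tsum => l1 l2.
by do 3 rewrite (scalable_linear (bl.2 _)).
Qed.

Definition crossed_product : comodule_algebra H :=
  @ComoduleAlgebra k H cp_comodule cp_mul cp_one cp_mul_bilin cp_coact_mul
    cp_coact_one cp_mul1x cp_mulx1 cp_mul_quasi_assoc.

End CrossedProduct.

Record category := Category {
  obj :> Type;
  hom : obj -> obj -> Type;
  idm : forall X, hom X X;
  comp : forall X Y Z, hom Y Z -> hom X Y -> hom X Z;
  comp_idl : forall X Y (f : hom X Y), comp (idm Y) f = f;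
  comp_idr : forall X Y (f : hom X Y), comp f (idm X) = f;
  comp_assoc : forall X Y Z T (h : hom Z T) (g : hom Y Z) (f : hom X Y),
    comp h (comp g f) = comp (comp h g) f
}.

Arguments idm {_} X.
Arguments comp {_ X Y Z} _ _.

Record functor (C D : category) := Functor {
  fobj :> C -> D;
  fmap : forall X Y, hom X Y -> hom (fobj X) (fobj Y);
  fmap_id : forall X, fmap (idm X) = idm (fobj X);
  fmap_comp : forall X Y Z (g : hom Y Z) (f : hom X Y),
    fmap (comp g f) = comp (fmap g) (fmap f)
}.

Definition id_functor (C : category) : functor C C :=
  @Functor C C id (fun _ _ => id) (fun _ => erefl) (fun _ _ _ _ _ => erefl).

Lemma comp_functor_id (C D E : category) (G : functor D E) (F : functor C D) X :
  fmap G (fmap F (idm X)) = idm (G (F X)).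
Proof. by rewrite !fmap_id. Qed.

Lemma comp_functor_comp (C D E : category) (G : functor D E) (F : functor C D)
    X Y Z (g : hom Y Z) (f : hom X Y) :
  fmap G (fmap F (comp g f)) = comp (fmap G (fmap F g)) (fmap G (fmap F f)).
Proof. by rewrite !fmap_comp. Qed.

Definition comp_functor (C D E : category) (G : functor D E) (F : functor C D) :
    functor C E :=
  @Functor C E (fun X => G (F X)) (fun _ _ f => fmap G (fmap F f))
    (comp_functor_id G F) (comp_functor_comp G F).

Definition isomorphic_categories (C D : category) : Prop :=
  exists (F : functor C D) (G : functor D C),
    comp_functor G F = id_functor C /\ comp_functor F G = id_functor D.

Lemma linear_ext (k : fieldType) (V W : lmodType k) (f g : {linear V -> W}) :
  f =1 g -> f = g.
Proof.
move=> /funext; case: f g => [f cf] [g cg] /= e; rewrite e in cf *.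
congr GRing.Linear.Pack; case: cf cg => [[a] [b]] [[c] [d]].
by congr GRing.Linear.Class; [congr Algebra.isNmodMorphism.phant_Build |
  congr GRing.isScalable.phant_Build]; exact: Prop_irrelevance.
Qed.

Section ColinearMaps.
Variables (k : fieldType) (H : coalgebra k).

Lemma colinear_id (M : comodule H) : colinear (@idfun M).
Proof. by move=> m; rewrite -tens_pureE. Qed.

Lemma colinear_comp (M N P : comodule H) (g : {linear N -> P})
    (f : {linear M -> N}) :
  colinear g -> colinear f -> colinear (g \o f).
Proof.
move=> cg cf m /=; rewrite cg cf tsum_tsum; last by lin.
by apply: eq_tsum => a b; rewrite tsum_pure //; lin.
Qed.

End ColinearMaps.

Section HopfModules.
Variables (k : fieldType) (H : coquasi_bialgebra k) (A : comodule_algebra H).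

Record hopf_module := HopfModule {
  hm_comod :> comodule H;
  hact : hm_comod -> A -> hm_comod;
  hact_bilin : bilin hact;
  hact_quasi_assoc : forall m a b,
    hact (hact m a) b
    = \tsum_(m0, m1 <- ρ m) \tsum_(a0, a1 <- ρ a) \tsum_(b0, b1 <- ρ b)
        omega m1 a1 b1 *: hact m0 (camul a0 b0);
  hact_one : forall m, hact m caone = m;
  coact_hact : forall m a,
    ρ (hact m a)
    = \tsum_(m0, m1 <- ρ m) \tsum_(a0, a1 <- ρ a) hact m0 a0 ⊗ cmul m1 a1
}.

Record hopf_module_hom (M N : hopf_module) := HopfModuleHom {
  hm_fun :> {linear M -> N};
  hm_colinear : colinear hm_fun;
  hm_hact : forall m a, hm_fun (hact m a) = hact (hm_fun m) a
}.

Lemma hm_hom_ext (M N : hopf_module) (f g : hopf_module_hom M N) :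
  f =1 g -> f = g.
Proof.
case: f g => [f cf hf] [g cg hg] /= /linear_ext e; subst g.
by congr HopfModuleHom; exact: Prop_irrelevance.
Qed.

Definition hm_id (M : hopf_module) : hopf_module_hom M M :=
  @HopfModuleHom M M idfun (@colinear_id k H M) (fun _ _ => erefl).

Lemma hm_comp_hact (M N P : hopf_module) (g : hopf_module_hom N P)
    (f : hopf_module_hom M N) m a : (g \o f) (hact m a) = hact ((g \o f) m) a.
Proof. by rewrite /= !hm_hact. Qed.

Definition hm_comp (M N P : hopf_module) (g : hopf_module_hom N P)
    (f : hopf_module_hom M N) : hopf_module_hom M P :=
  @HopfModuleHom M P (g \o f) (colinear_comp (hm_colinear g) (hm_colinear f))
    (hm_comp_hact g f).

Lemma hm_comp_idl (M N : hopf_module) (f : hopf_module_hom M N) :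
  hm_comp (hm_id N) f = f.
Proof. exact: hm_hom_ext. Qed.

Lemma hm_comp_idr (M N : hopf_module) (f : hopf_module_hom M N) :
  hm_comp f (hm_id M) = f.
Proof. exact: hm_hom_ext. Qed.

Lemma hm_comp_assoc (M N P Q : hopf_module) (h : hopf_module_hom P Q)
    (g : hopf_module_hom N P) (f : hopf_module_hom M N) :
  hm_comp h (hm_comp g f) = hm_comp (hm_comp h g) f.
Proof. exact: hm_hom_ext. Qed.

Definition hopf_module_cat : category :=
  @Category hopf_module hopf_module_hom hm_id hm_comp hm_comp_idl hm_comp_idr
    hm_comp_assoc.

End HopfModules.

Section CoquasiHopfModules.
Variables (k : fieldType) (H : coquasi_bialgebra k) (R : algebra k).

(* Objects of the category of right R-modules in right H-comodules. *)
Record rmod_comodule := RmodComodule {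
  rm_comod :> comodule H;
  ract : rm_comod -> R -> rm_comod;
  ract_bilin : bilin ract;
  ractA : forall m r s, ract (ract m r) s = ract m (amul r s);
  ract_one : forall m, ract m aone = m;
  coact_ract : forall m r,
    ρ (ract m r) = \tsum_(m0, m1 <- ρ m) ract m0 r ⊗ m1
}.

Variable S : crossed_system H R.

Record coquasi_hopf_module := CoquasiHopfModule {
  chm_rmod :> rmod_comodule;
  circ : chm_rmod -> H -> chm_rmod;
  circ_bilin : bilin circ;
  coact_circ : forall m h,
    ρ (circ m h)
    = \tsum_(m0, m1 <- ρ m) \tsum_(h1, h2 <- Δ h) circ m0 h1 ⊗ cmul m1 h2;
  circ_ract : forall m h r,
    ract (circ m h) r = \tsum_(h1, h2 <- Δ h) circ (ract m (act S h1 r)) h2;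
  circ_circ : forall m h g,
    circ (circ m h) g
    = \tsum_(m0, m1 <- ρ m)
      \tsum_(h1, h' <- Δ h) \tsum_(h2, h3 <- Δ h')
      \tsum_(g1, g' <- Δ g) \tsum_(g2, g3 <- Δ g')
        omega m1 h3 g3 *: circ (ract m0 (sigma S h1 g1)) (cmul h2 g2);
  circ_one : forall m, circ m cone = m
}.

Record coquasi_hopf_module_hom (M N : coquasi_hopf_module) :=
    CoquasiHopfModuleHom {
  chm_fun :> {linear M -> N};
  chm_colinear : colinear chm_fun;
  chm_ract : forall m r, chm_fun (ract m r) = ract (chm_fun m) r;
  chm_circ : forall m h, chm_fun (circ m h) = circ (chm_fun m) h
}.

Lemma chm_hom_ext (M N : coquasi_hopf_module)
    (f g : coquasi_hopf_module_hom M N) : f =1 g -> f = g.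
Proof.
case: f g => [f cf rf hf] [g cg rg hg] /= /linear_ext e; subst g.
by congr CoquasiHopfModuleHom; exact: Prop_irrelevance.
Qed.

Definition chm_id (M : coquasi_hopf_module) : coquasi_hopf_module_hom M M :=
  @CoquasiHopfModuleHom M M idfun (@colinear_id k H M) (fun _ _ => erefl)
    (fun _ _ => erefl).

Lemma chm_comp_ract (M N P : coquasi_hopf_module)
    (g : coquasi_hopf_module_hom N P) (f : coquasi_hopf_module_hom M N) m r :
  (g \o f) (ract m r) = ract ((g \o f) m) r.
Proof. by rewrite /= !chm_ract. Qed.

Lemma chm_comp_circ (M N P : coquasi_hopf_module)
    (g : coquasi_hopf_module_hom N P) (f : coquasi_hopf_module_hom M N) m h :
  (g \o f) (circ m h) = circ ((g \o f) m) h.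
Proof. by rewrite /= !chm_circ. Qed.

Definition chm_comp (M N P : coquasi_hopf_module)
    (g : coquasi_hopf_module_hom N P) (f : coquasi_hopf_module_hom M N) :
    coquasi_hopf_module_hom M P :=
  @CoquasiHopfModuleHom M P (g \o f)
    (colinear_comp (chm_colinear g) (chm_colinear f))
    (chm_comp_ract g f) (chm_comp_circ g f).

Lemma chm_comp_idl (M N : coquasi_hopf_module)
    (f : coquasi_hopf_module_hom M N) : chm_comp (chm_id N) f = f.
Proof. exact: chm_hom_ext. Qed.

Lemma chm_comp_idr (M N : coquasi_hopf_module)
    (f : coquasi_hopf_module_hom M N) : chm_comp f (chm_id M) = f.
Proof. exact: chm_hom_ext. Qed.

Lemma chm_comp_assoc (M N P Q : coquasi_hopf_module)
    (h : coquasi_hopf_module_hom P Q) (g : coquasi_hopf_module_hom N P)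
    (f : coquasi_hopf_module_hom M N) :
  chm_comp h (chm_comp g f) = chm_comp (chm_comp h g) f.
Proof. exact: chm_hom_ext. Qed.

Definition coquasi_hopf_module_cat : category :=
  @Category coquasi_hopf_module coquasi_hopf_module_hom chm_id chm_comp
    chm_comp_idl chm_comp_idr chm_comp_assoc.

End CoquasiHopfModules.

(* Main.v *)
Require Import Defs.
From mathcomp Require Import all_boot all_algebra.
From mathcomp Require Import boolp.

Set Implicit Arguments.
Unset Strict Implicit.
Unset Printing Implicit Defensive.

Import GRing.Theory.

Local Open Scope ring_scope.

(** In the crossed product every r ⊗ h is the product (r ⊗ 1)(1 ⊗ h), so an
    action of it is determined by the actions of R ⊗ 1 and of 1 ⊗ H.  The two
    functors, which keep the underlying comodule and the underlying maps, are

      m (r ⊗ h) := (m r) ∘ h    and    m r := m (r ⊗ 1),  m ∘ h := m (1 ⊗ h).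

    The axioms correspond because (r ⊗ 1) y = r y (cp_mul_R),
    (1 ⊗ h)(r ⊗ 1) is the sum of the (h1 ▷ r) ⊗ h2 (cp_mul_HR), and
    (1 ⊗ h)(1 ⊗ g) = cp_Y h g, the sum of the σ(h1, g1) ⊗ h2 g2 (cp_mul_H).
    These are the straightening rules behind the three axioms: R acts
    associatively, (m ∘ h) r moves r past h, and (m ∘ h) ∘ g involves σ and
    omega.  The rule for (m ∘ h) ∘ g is used in the form of crossed_act_Y, in
    which it reads as quasi-associativity on 1 ⊗ H.

    Quasi-associativity of a Hopf module inserts omega(m, a, b).  For a or b
    in R ⊗ 1, whose coaction is trivial, one argument of omega is 1 and
    omega must disappear.  In the middle slot this is an axiom; in the last
    slot it is omega_hg1: the cocycle identity makes h, g |-> omega(h, g, 1)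
    idempotent for convolution, and it is invertible.

    Restricting the action of a coquasi-Hopf module gives back its structure
    because 1 acts trivially on either side, and the restrictions of a Hopf
    module rebuild its action by crossed_act_res.  The composites are
    therefore identities on objects, and on morphisms, whose underlying maps
    never change (functor_eq_id). *)

(** * The reassociator at the unit *)

(** A k-valued sum lives in the field itself, where the vector-space lemma
    tsum_pure does not rewrite; this is its form for scalars. *)
Lemma tsum_pure_form (k : fieldType) (V W : lmodType k) (f : V -> W -> k) v w :
  bilin (f : V -> W -> k^o) -> tsum f (v ⊗ w) = f v w.
Proof. exact: tsum_pure. Qed.

Section OmegaUnit.
Variables (k : fieldType) (H : coquasi_bialgebra k).

Lemma conv2_counitl (U : lmodType k) (F : H -> H -> U) h g : bilin F ->
  conv2 (fun (a : k^o) v => a *: v) (fun h g => ε h * ε g : k^o) F h g = F h g.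
Proof.
move=> bF; rewrite -[RHS](counitl_lin (f := F^~ g)); last by case: bF.
apply: eq_tsum => h1 h2.
rewrite -[F h2 g](counitl_lin (f := F h2)); last by case: bF.
rewrite (linear_tsum (g := fun x => ε h1 *: x)); last by lin.
by apply: eq_tsum => g1 g2; rewrite scalerA.
Qed.

Lemma conv2_counitr (U : lmodType k) (F : H -> H -> U) h g : bilin F ->
  conv2 (fun v (a : k^o) => a *: v) F (fun h g => ε h * ε g : k^o) h g = F h g.
Proof.
move=> bF; rewrite -[RHS](counitr_lin (f := F^~ g)); last by case: bF.
apply: eq_tsum => h1 h2.
rewrite -[F h1 g](counitr_lin (f := F h1)); last by case: bF.
rewrite (linear_tsum (g := fun x => ε h2 *: x)); last by lin.
by apply: eq_tsum => g1 g2; rewrite scalerA.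
Qed.

Local Notation f := (fun h g : H => omega h g cone : k^o).

Lemma omega_hg1_bilin : bilin f.
Proof. by have [o1 o2 _] := omega_trilin H; split=> x; [exact: o1|exact: o2]. Qed.

(** The cocycle identity at (h, g, 1, 1): the factors omega(h2 g2, 1, 1) and
    omega(g1, 1, 1) are counits, which leaves f = f * f under convolution. *)
Lemma omega_hg1_idem h g :
  conv2 (fun a b : k^o => a * b : k^o) f f h g = omega h g cone.
Proof.
have bf := omega_hg1_bilin.
transitivity (conv2 (fun (v a : k^o) => a *: v) f
  (fun h g => ε h * ε g : k^o) h g); last exact: conv2_counitr.
have bk := kmul_bilin k.
have := omega_cocycle h g cone cone.
rewrite !Delta_one => e; symmetry.
transitivity (\tsum_(h1, h2 <- Δ h) \tsum_(g1, g2 <- Δ g)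
  \tsum_(l1, l2 <- (cone : H) ⊗ (cone : H))
  \tsum_(n1, n2 <- (cone : H) ⊗ (cone : H))
    omega h1 g1 (cmul l1 n1) * omega (cmul h2 g2) l2 n2).
  apply: eq_tsum => h1 h2; apply: eq_tsum => g1 g2.
  rewrite tsum_pure_form; last by lin.
  rewrite tsum_pure_form; last by lin.
  by rewrite cmul1h omega_one counit_mul counit_one mulr1 [RHS]mulrC.
rewrite [LHS]e; apply: eq_tsum => h1 h2.
transitivity (\tsum_(g1, g' <- Δ g) ε g1 *: (\tsum_(g2, g3 <- Δ g')
   (f h1 g2 * f h2 g3 : k^o))); last first.
  rewrite (counitl_lin (f := fun x =>
    \tsum_(g2, g3 <- Δ x) (f h1 g2 * f h2 g3 : k^o))) //.
  apply: lin_tsum; last exact: linearP.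
  by split=> x; [exact: lin_bl bk (bf.2 h1)|exact: lin_br bk (bf.2 h2)].
apply: eq_tsum => g1 g'.
rewrite [RHS](linear_tsum (g := fun x : k^o => ε g1 *: x)); last first.
  exact: lin_scaler (@lin_id _ _).
apply: eq_tsum => g2 g3.
rewrite tsum_pure_form; last by lin.
rewrite Delta_one tsum_pure_form; last by lin.
rewrite tsum_pure_form; last by lin.
by rewrite omega_one counit_one mulr1 cmulh1 -mulrA.
Qed.

(** A convolution idempotent with a left inverse is the convolution unit.  Only
    the middle slot is normalised by definition; the last slot is needed to
    evaluate (m a)(r ⊗ 1). *)
Lemma omega_hg1 h g : omega h g (cone : H) = ε h * ε g.
Proof.
have bf := omega_hg1_bilin; have bk := kmul_bilin k.
have bi : bilin (fun h g : H => omega_inv h g cone : k^o).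
  by have [o1 o2 _] := omega_inv_trilin H; split=> x; [exact: o1|exact: o2].
have inv h' g' : conv2 (fun a b : k^o => a * b : k^o)
    (fun h g : H => omega_inv h g cone : k^o) f h' g' = ε h' * ε g'.
  have := omega_inv_omega h' g' cone.
  rewrite Delta_one counit_one mulr1 => <-.
  apply: eq_tsum => h1 h2; apply: eq_tsum => g1 g2.
  by rewrite tsum_pure_form //; lin.
rewrite -inv -[LHS](conv2_counitl _ _ bf).
transitivity (conv2 (fun a b : k^o => a * b : k^o)
  (conv2 (fun a b : k^o => a * b : k^o)
    (fun h g : H => omega_inv h g cone : k^o) f) f h g).
  by apply: eq_tsum => h1 h2; apply: eq_tsum => g1 g2; rewrite inv.
rewrite (conv2A (op'' := fun a b : k^o => a * b : k^o)
  (op''' := fun a b : k^o => a * b : k^o)) //; last by move=> *; rewrite mulrA.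
by apply: eq_tsum => h1 h2; apply: eq_tsum => g1 g2; rewrite omega_hg1_idem.
Qed.

End OmegaUnit.

(** * The action of the crossed product defined by R and H *)

Section CrossedAction.
Variables (k : fieldType) (H : coquasi_bialgebra k) (R : algebra k)
  (S : crossed_system H R).
Variables (M : comodule H) (ra : M -> R -> M) (ci : M -> H -> M).
Hypotheses (bra : bilin ra) (bci : bilin ci).

(** The action (m, r ⊗ h) |-> (m r) ∘ h, for bare bilinear maps: it is formed
    both from a coquasi-Hopf module and from the two restrictions of a Hopf
    module, before these are known to satisfy any axiom. *)
Definition crossed_act (m : M) (x : (R ⊗ H)%type) : M :=
  \tsum_(r, h <- x) ci (ra m r) h.

Lemma crossed_act_bilin : bilin crossed_act.
Proof. by rewrite /crossed_act; lin. Qed.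

Lemma crossed_act_pure m r h : crossed_act m (r ⊗ h) = ci (ra m r) h.
Proof. by rewrite /crossed_act tsum_pure //; lin. Qed.

Lemma crossed_act_lact m r x :
  (forall m r s, ra (ra m r) s = ra m (amul r s)) ->
  crossed_act m (lact r x) = crossed_act (ra m r) x.
Proof.
move=> raA; have bl := lact_bilin H R; have bc := crossed_act_bilin.
apply: (tensor_ext (f := fun x => crossed_act m (lact r x))
  (g := crossed_act (ra m r))) => [||s h].
- by apply: lin_br; [|apply: lin_bilr].
- by apply: lin_bilr.
- by rewrite lact_pure !crossed_act_pure raA.
Qed.

(** The left side is the right side of the axiom for (m ∘ h) ∘ g.  As
    cp_Y h g = (1 ⊗ h)(1 ⊗ g), this turns that axiom into the case of
    elements 1 ⊗ h and 1 ⊗ g of the quasi-associativity of the action; both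
    directions of the correspondence use it. *)
Lemma crossed_act_Y m h g :
  \tsum_(m0, m1 <- ρ m)
  \tsum_(h1, h' <- Δ h) \tsum_(h2, h3 <- Δ h')
  \tsum_(g1, g' <- Δ g) \tsum_(g2, g3 <- Δ g')
    omega m1 h3 g3 *: ci (ra m0 (sigma S h1 g1)) (cmul h2 g2)
  = \tsum_(m0, m1 <- ρ m) \tsum_(h1, h2 <- Δ h) \tsum_(g1, g2 <- Δ g)
      omega m1 h2 g2 *: crossed_act m0 (cp_Y S h1 g1).
Proof.
have bc := crossed_act_bilin.
apply: eq_tsum => m0 m1.
transitivity (\tsum_(h1, h' <- Δ h) \tsum_(g1, g' <- Δ g)
   \tsum_(h2, h3 <- Δ h') \tsum_(g2, g3 <- Δ g')
    omega m1 h3 g3 *: ci (ra m0 (sigma S h1 g1)) (cmul h2 g2)).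
  by apply: eq_tsum => h1 h'; rewrite tsum_exchange.
rewrite -(coassoc_bi (P := fun h1 h2 h3 g1 g2 g3 =>
    omega m1 h3 g3 *: ci (ra m0 (sigma S h1 g1)) (cmul h2 g2))); last 2 first.
- by move=> *; split=> * /=; lin.
- by move=> *; split=> * /=; lin.
apply: eq_tsum => h' h3; apply: eq_tsum => g' g3.
rewrite (linear_tsum (g := fun x => omega m1 h3 g3 *: crossed_act m0 x)); last first.
  by apply: lin_scaler; exact: lin_bilr.
apply: eq_tsum => h1 h2.
rewrite (linear_tsum (g := fun x => omega m1 h3 g3 *: crossed_act m0 x)); last first.
  by apply: lin_scaler; exact: lin_bilr.
by apply: eq_tsum => g1 g2; rewrite crossed_act_pure.
Qed.

End CrossedAction.

(** * From coquasi-Hopf modules to Hopf modules *)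

Section ToHopf.
Variables (k : fieldType) (H : coquasi_bialgebra k) (R : algebra k)
  (S : crossed_system H R).

Section Objects.
Variable M : coquasi_hopf_module S.

Local Notation cact := (crossed_act (@ract _ _ _ M) (@circ _ _ _ _ M)).

Let bra : bilin (@ract _ _ _ M) := ract_bilin M.
Let bci : bilin (@circ _ _ _ _ M) := circ_bilin M.
Let bact : bilin cact := crossed_act_bilin bra bci.

(** In (((m r) ∘ h) s) ∘ g, the axiom for (m ∘ h) s moves s to the left of h,
    giving ((m r (h1 ▷ s)) ∘ h2) ∘ g; crossed_act_Y then yields
    r (h1 ▷ s) (1 ⊗ h2)(1 ⊗ g), which sums to the product (r ⊗ h)(s ⊗ g) once
    coassociativity has separated the component of h that feeds omega. *)
Lemma crossed_act_quasi_assoc (m : M) (a b : (R ⊗ H)%type) :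
  cact (cact m a) b
  = \tsum_(m0, m1 <- ρ m) \tsum_(a0, a1 <- cp_coact a) \tsum_(b0, b1 <- cp_coact b)
      omega m1 a1 b1 *: cact m0 (cp_mul S a0 b0).
Proof.
have bl := lact_bilin H R; have bY := cp_Y_bilin S; have bm := cp_mul_bilin S.
have bp := cp_phi_bilin S; have lc := @cp_coact_linear k H R.
move: a b; apply: eq_tensor2.
- by split=> x; [apply: lin_bl|]; first [assumption | exact: lin_bilr].
- by split=> x; lin.
move=> r h s g.
(* The left side, expanded; h1 acts on s, a and b split the rest of h. *)
transitivity (\tsum_(h1, h2 <- Δ h) \tsum_(m0, m1 <- ρ m)
  \tsum_(a, b <- Δ h2) \tsum_(g1, g2 <- Δ g) omega m1 b g2 *:
    cact (ract m0 (amul r (act S h1 s))) (cp_Y S a g1)).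
  rewrite !crossed_act_pure // circ_ract.
  rewrite (linear_tsum (g := fun x => @circ _ _ _ _ M x g)); last first.
    by case: bci.
  apply: eq_tsum => h1 h2; rewrite circ_circ crossed_act_Y // ractA coact_ract.
  rewrite tsum_tsum; last by lin.
  by apply: eq_tsum => m0 m1; rewrite tsum_pure //; lin.
rewrite tsum_exchange; apply: eq_tsum => m0 m1; rewrite !cp_coact_pure.
rewrite -(coassoc_trilin (F := fun h1 a b => \tsum_(g1, g2 <- Δ g)
  omega m1 b g2 *: cact (ract m0 (amul r (act S h1 s))) (cp_Y S a g1)));
  last by lin.
rewrite tsum_tsum; last by lin.
apply: eq_tsum => h' h3; rewrite tsum_pure; last by lin.
rewrite tsum_tsum; last by lin.
rewrite tsum_exchange; apply: eq_tsum => g1 g2; rewrite tsum_pure; last by lin.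
rewrite cp_mul_phi cp_phi_pure (linear_tsum (g := lact r)); last by lin.
rewrite (linear_tsum (g := fun x => omega m1 h3 g2 *: cact m0 x)); last first.
  by apply: lin_scaler; exact: lin_bilr.
apply: eq_tsum => h1 h2; rewrite -lactA crossed_act_lact //.
exact: ractA.
Qed.

Lemma crossed_act_one (m : M) : cact m (@cp_one k H R) = m.
Proof. by rewrite crossed_act_pure // ract_one circ_one. Qed.

Lemma coact_crossed_act (m : M) (a : (R ⊗ H)%type) :
  ρ (cact m a)
  = \tsum_(m0, m1 <- ρ m) \tsum_(a0, a1 <- cp_coact a) cact m0 a0 ⊗ cmul m1 a1.
Proof.
have lc := @cp_coact_linear k H R.
apply: (tensor_ext (f := fun a => ρ (cact m a)) (g := fun a =>
  \tsum_(m0, m1 <- ρ m) \tsum_(a0, a1 <- cp_coact a) cact m0 a0 ⊗ cmul m1 a1)).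
- by apply: lin_app; exact: lin_bilr.
- by lin.
move=> r h; rewrite crossed_act_pure // coact_circ coact_ract tsum_tsum; last by lin.
apply: eq_tsum => m0 m1; rewrite tsum_pure; last by lin.
rewrite cp_coact_pure tsum_tsum; last by lin.
apply: eq_tsum => h1 h2; rewrite tsum_pure; last by lin.
by rewrite crossed_act_pure.
Qed.

Definition to_hopf : hopf_module (crossed_product S) :=
  @HopfModule k H (crossed_product S) M cact bact crossed_act_quasi_assoc
    crossed_act_one coact_crossed_act.

End Objects.

Lemma crossed_act_hom (M N : coquasi_hopf_module S)
    (f : coquasi_hopf_module_hom M N) (m : M) (a : (R ⊗ H)%type) :
  f (crossed_act (@ract _ _ _ M) (@circ _ _ _ _ M) m a)
  = crossed_act (@ract _ _ _ N) (@circ _ _ _ _ N) (f m) a.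
Proof.
rewrite (linear_tsum (g := f)); last exact: linearP.
by apply: eq_tsum => r h; rewrite chm_circ chm_ract.
Qed.

Definition to_hopf_hom (M N : coquasi_hopf_module S)
    (f : coquasi_hopf_module_hom M N) :
    hopf_module_hom (to_hopf M) (to_hopf N) :=
  @HopfModuleHom k H (crossed_product S) (to_hopf M) (to_hopf N) f
    (chm_colinear f) (crossed_act_hom f).

Lemma to_hopf_hom_id M : to_hopf_hom (chm_id M) = hm_id (to_hopf M).
Proof. exact: hm_hom_ext. Qed.

Lemma to_hopf_hom_comp M N P (g : coquasi_hopf_module_hom N P)
    (f : coquasi_hopf_module_hom M N) :
  to_hopf_hom (chm_comp g f) = hm_comp (to_hopf_hom g) (to_hopf_hom f).
Proof. exact: hm_hom_ext. Qed.

Definition to_hopf_functor :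
    functor (coquasi_hopf_module_cat S) (hopf_module_cat (crossed_product S)) :=
  @Functor (coquasi_hopf_module_cat S) (hopf_module_cat (crossed_product S))
    to_hopf to_hopf_hom to_hopf_hom_id to_hopf_hom_comp.

End ToHopf.

(** * From Hopf modules to coquasi-Hopf modules *)

(** What remains of quasi-associativity when omega degenerates to a product of
    counits: the action is then strictly associative. *)
Lemma coact_counit2 (k : fieldType) (H : coalgebra k) (M N : comodule H)
    (U : lmodType k) (F : M -> N -> U) m n : bilin F ->
  \tsum_(m0, m1 <- ρ m) \tsum_(n0, n1 <- ρ n) (ε m1 * ε n1) *: F m0 n0 = F m n.
Proof.
move=> bF; have [bF1 bF2] := bF.
rewrite -[in RHS](coact_counit m) (linear_tsum (g := F^~ n)) //.
apply: eq_tsum => m0 m1; rewrite -[in RHS](coact_counit n).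
rewrite (linear_tsum (g := F _)) //.
apply: eq_tsum => n0 n1.
have -> : F (ε m1 *: m0) (ε n1 *: n0) = ε n1 *: (ε m1 *: F m0 n0).
  by rewrite (scalable_linear (bF2 _)) /= (scalable_linear (bF1 _)).
by rewrite scalerA mulrC.
Qed.

Section OfHopf.
Variables (k : fieldType) (H : coquasi_bialgebra k) (R : algebra k)
  (S : crossed_system H R).

Lemma lact1 (x : (R ⊗ H)%type) : lact aone x = x.
Proof.
have bl := lact_bilin H R.
apply: (tensor_ext (f := lact aone) (g := id)) => [||r h].
- exact: lin_bilr.
- exact: lin_id.
- by rewrite lact_pure amul1r.
Qed.

Lemma lact_oner r : lact r (cp_one H R) = r ⊗ (cone : H).
Proof. by rewrite lact_pure amulr1. Qed.

Lemma cp_mul_R r (y : (R ⊗ H)%type) : cp_mul S (r ⊗ cone) y = lact r y.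
Proof. by rewrite -lact_oner cp_mul_lact cp_mul1x. Qed.

Lemma cp_mul_H (h g : H) : cp_mul S (aone ⊗ h) (aone ⊗ g) = cp_Y S h g.
Proof.
have bl := lact_bilin H R; have bY := cp_Y_bilin S.
rewrite cp_mul_phi lact1 cp_phi_pure.
rewrite -[RHS](counitl_lin (f := (cp_Y S)^~ g)); last by case: bY.
apply: eq_tsum => h1 h2.
by rewrite act_one (scalable_linear (bl.1 _)) lact1.
Qed.

Lemma cp_mul_HR (h : H) r :
  cp_mul S (aone ⊗ h) (r ⊗ cone) = \tsum_(h1, h2 <- Δ h) act S h1 r ⊗ h2.
Proof.
rewrite cp_mul_phi lact1 cp_phi_pure; apply: eq_tsum => h1 h2.
by rewrite -cp_mul_H cp_mulx1 lact_pure amulr1.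
Qed.

(** The action ha is typed on R ⊗ H, rather than on the carrier of the
    crossed-product comodule algebra, so that bilinearity of expressions in
    pure tensors is found by unification. *)
Section Restriction.
Variables (N : comodule H) (ha : N -> (R ⊗ H)%type -> N).
Hypotheses (bha : bilin ha)
  (haA : forall n x y, ha (ha n x) y
     = \tsum_(n0, n1 <- ρ n) \tsum_(x0, x1 <- cp_coact x)
       \tsum_(y0, y1 <- cp_coact y) omega n1 x1 y1 *: ha n0 (cp_mul S x0 y0))
  (ha1 : forall n, ha n (cp_one H R) = n)
  (coact_ha : forall n x, ρ (ha n x)
     = \tsum_(n0, n1 <- ρ n) \tsum_(x0, x1 <- cp_coact x)
         ha n0 x0 ⊗ cmul n1 x1).

Definition res_ract n r := ha n (r ⊗ cone).
Definition res_circ n h := ha n (aone ⊗ h).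

Lemma res_ract_bilin : bilin res_ract.
Proof. by rewrite /res_ract; lin. Qed.

Lemma res_circ_bilin : bilin res_circ.
Proof. by rewrite /res_circ; lin. Qed.

Lemma cp_coact_R (r : R) : cp_coact (r ⊗ (cone : H)) = r ⊗ cone ⊗ cone.
Proof. by rewrite cp_coact_pure Delta_one tsum_pure //; lin. Qed.

(** R ⊗ 1 has trivial coaction, so here omega has 1 in its middle slot. *)
Lemma ha_R_l n r y : ha (ha n (r ⊗ cone)) y = ha n (lact r y).
Proof.
have bl := lact_bilin H R; have bm := cp_mul_bilin S.
rewrite -(@coact_counit2 _ _ N (cp_comodule H R) _ (fun n y => ha n (lact r y)));
  last by split=> x; [exact: bha.1|apply: lin_br; [|exact: lin_bilr]].
rewrite haA; apply: eq_tsum => n0 n1; rewrite cp_coact_R tsum_pure; last by lin.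
by apply: eq_tsum => y0 y1; rewrite omega_one cp_mul_R.
Qed.

(** Here omega has 1 in its last slot. *)
Lemma ha_R_r n x r : ha (ha n x) (r ⊗ cone) = ha n (cp_mul S x (r ⊗ cone)).
Proof.
have bm := cp_mul_bilin S; have lc := @cp_coact_linear k H R.
rewrite -(@coact_counit2 _ _ N (cp_comodule H R) _
  (fun n x => ha n (cp_mul S x (r ⊗ cone))));
  last by split=> z; [exact: bha.1|lin].
rewrite haA; apply: eq_tsum => n0 n1; apply: eq_tsum => x0 x1.
by rewrite cp_coact_R tsum_pure ?omega_hg1 //; lin.
Qed.

(** Because r ⊗ h = (r ⊗ 1)(1 ⊗ h), and the action is associative on such a
    product. *)
Lemma crossed_act_res n x : crossed_act res_ract res_circ n x = ha n x.
Proof.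
have bc := crossed_act_bilin res_ract_bilin res_circ_bilin.
apply: (tensor_ext (f := crossed_act res_ract res_circ n) (g := ha n)).
- exact: lin_bilr.
- exact: lin_bilr.
move=> r h; rewrite crossed_act_pure; first last.
- exact: res_circ_bilin.
- exact: res_ract_bilin.
by rewrite /res_circ ha_R_l lact_pure amulr1.
Qed.

Lemma res_ractA n r s : res_ract (res_ract n r) s = res_ract n (amul r s).
Proof. by rewrite /res_ract ha_R_l lact_pure. Qed.

Lemma coact_res_ract n r :
  ρ (res_ract n r) = \tsum_(n0, n1 <- ρ n) res_ract n0 r ⊗ n1.
Proof.
rewrite coact_ha; apply: eq_tsum => n0 n1.
by rewrite cp_coact_R tsum_pure ?cmulh1 //; lin.
Qed.

Definition res_rmod : rmod_comodule H R :=
  @RmodComodule k H R N res_ract res_ract_bilin res_ractA ha1 coact_res_ract.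

Lemma coact_res_circ n h :
  ρ (res_circ n h)
  = \tsum_(n0, n1 <- ρ n) \tsum_(h1, h2 <- Δ h) res_circ n0 h1 ⊗ cmul n1 h2.
Proof.
rewrite coact_ha; apply: eq_tsum => n0 n1.
rewrite cp_coact_pure tsum_tsum; last by lin.
by apply: eq_tsum => h1 h2; rewrite tsum_pure //; lin.
Qed.

Lemma res_circ_ract n h r :
  res_ract (res_circ n h) r
  = \tsum_(h1, h2 <- Δ h) res_circ (res_ract n (act S h1 r)) h2.
Proof.
rewrite /res_ract /res_circ ha_R_r cp_mul_HR (linear_tsum (g := ha n)); last first.
  exact: lin_bilr.
by apply: eq_tsum => h1 h2; rewrite ha_R_l lact_pure amulr1.
Qed.

Lemma res_circ_circ n h g :
  res_circ (res_circ n h) g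
  = \tsum_(n0, n1 <- ρ n)
    \tsum_(h1, h' <- Δ h) \tsum_(h2, h3 <- Δ h')
    \tsum_(g1, g' <- Δ g) \tsum_(g2, g3 <- Δ g')
      omega n1 h3 g3 *: res_circ (res_ract n0 (sigma S h1 g1)) (cmul h2 g2).
Proof.
have bm := cp_mul_bilin S; have lc := @cp_coact_linear k H R.
rewrite crossed_act_Y; first last.
- exact: res_circ_bilin.
- exact: res_ract_bilin.
rewrite [LHS]haA; apply: eq_tsum => n0 n1; rewrite !cp_coact_pure.
rewrite tsum_tsum; last by lin.
apply: eq_tsum => h1 h2; rewrite tsum_pure; last by lin.
rewrite tsum_tsum; last by lin.
apply: eq_tsum => g1 g2; rewrite tsum_pure; last by lin.
by rewrite cp_mul_H crossed_act_res.
Qed.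

Definition res_module : coquasi_hopf_module S :=
  @CoquasiHopfModule k H R S res_rmod res_circ res_circ_bilin coact_res_circ
    res_circ_ract res_circ_circ ha1.

End Restriction.

Definition of_hopf (N : hopf_module (crossed_product S)) : coquasi_hopf_module S :=
  @res_module N (@hact _ _ _ N) (hact_bilin N) (@hact_quasi_assoc _ _ _ N)
    (@hact_one _ _ _ N) (@coact_hact _ _ _ N).

Definition of_hopf_hom (M N : hopf_module (crossed_product S))
    (f : hopf_module_hom M N) : coquasi_hopf_module_hom (of_hopf M) (of_hopf N) :=
  @CoquasiHopfModuleHom k H R S (of_hopf M) (of_hopf N) f (hm_colinear f)
    (fun m r => hm_hact f m _) (fun m h => hm_hact f m _).

Lemma of_hopf_hom_id M : of_hopf_hom (hm_id M) = chm_id (of_hopf M).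
Proof. exact: chm_hom_ext. Qed.

Lemma of_hopf_hom_comp M N P (g : hopf_module_hom N P) (f : hopf_module_hom M N) :
  of_hopf_hom (hm_comp g f) = chm_comp (of_hopf_hom g) (of_hopf_hom f).
Proof. exact: chm_hom_ext. Qed.

Definition of_hopf_functor :
    functor (hopf_module_cat (crossed_product S)) (coquasi_hopf_module_cat S) :=
  @Functor (hopf_module_cat (crossed_product S)) (coquasi_hopf_module_cat S)
    of_hopf of_hopf_hom of_hopf_hom_id of_hopf_hom_comp.

End OfHopf.

(** * Equality of functors and of modules *)

(** Two functors are equal only if they agree on objects as terms, after which
    morphisms live in different types.  Comparing instead the underlying maps
    u f, which determine f, avoids this: when U (F X) and U X are convertible,
    eU is reflexivity and the casts vanish. *)
Lemma functor_eq_id (C : category) (T : Type) (E : T -> T -> Type)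
    (U : C -> T) (u : forall X Y : C, Defs.hom X Y -> E (U X) (U Y))
    (F : functor C C) (eU : forall X, U (F X) = U X) :
  (forall X Y, injective (@u X Y)) ->
  (forall X, F X = X) ->
  (forall X Y (f : Defs.hom X Y),
     ecast A (E A (U Y)) (eU X) (ecast B (E _ B) (eU Y) (u _ _ (fmap F f)))
     = u _ _ f) ->
  F = id_functor C.
Proof.
case: F eU => fo fm fi fc /= eU u_inj /funext eo; subst fo => em.
have {}em : fm = fun _ _ => id.
  apply/functional_extensionality_dep => X; apply/functional_extensionality_dep => Y.
  apply/funext => f; apply: u_inj; rewrite -[RHS](em X Y f).
  (* With F the identity on objects, eU X is a loop at U X. *)
  by rewrite (Prop_irrelevance (eU X) erefl) (Prop_irrelevance (eU Y) erefl).
subst fm; rewrite /id_functor.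
by rewrite (Prop_irrelevance fi (fun _ => erefl))
  (Prop_irrelevance fc (fun _ _ _ _ _ => erefl)).
Qed.

Section ModuleEquality.
Variables (k : fieldType) (H : coquasi_bialgebra k).

(** The casts along e vanish when the two comodules are convertible, which is
    the case in both applications. *)
Lemma hopf_module_eq (A : comodule_algebra H) (M M' : hopf_module A)
    (e : M = M' :> comodule H) :
  (forall m a, hact (ecast N (comod_sort N) e m) a
     = ecast N (comod_sort N) e (hact m a)) ->
  M = M'.
Proof.
case: M M' e => [N ha b1 b2 b3 b4] [N' ha' c1 c2 c3 c4] /= e; subst N' => /= eh.
have {}eh : ha' = ha by apply/funext => m; apply/funext => a.
by subst ha'; congr HopfModule; exact: Prop_irrelevance.
Qed.

Lemma coquasi_hopf_module_eq (R : algebra k) (S : crossed_system H R)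
    (M M' : coquasi_hopf_module S) (e : M = M' :> comodule H) :
  (forall m r, ract (ecast N (comod_sort N) e m) r
     = ecast N (comod_sort N) e (ract m r)) ->
  (forall m h, circ (ecast N (comod_sort N) e m) h
     = ecast N (comod_sort N) e (circ m h)) ->
  M = M'.
Proof.
case: M M' e => [[N ra b1 b2 b3 b4] ci b5 b6 b7 b8 b9].
case=> [[N' ra' c1 c2 c3 c4] ci' c5 c6 c7 c8 c9] /= e; subst N' => /= er ec.
have {}er : ra' = ra by apply/funext => m; apply/funext => a.
have {}ec : ci' = ci by apply/funext => m; apply/funext => a.
subst ra' ci'.
have ?: b1 = c1 by exact: Prop_irrelevance.
have ?: b2 = c2 by exact: Prop_irrelevance.
have ?: b3 = c3 by exact: Prop_irrelevance.
have ?: b4 = c4 by exact: Prop_irrelevance.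
subst c1 c2 c3 c4.
by congr CoquasiHopfModule; exact: Prop_irrelevance.
Qed.

End ModuleEquality.

(** * The isomorphism *)

Section Inverse.
Variables (k : fieldType) (H : coquasi_bialgebra k) (R : algebra k)
  (S : crossed_system H R).

Lemma to_hopfK : cancel (@to_hopf k H R S) (@of_hopf k H R S).
Proof.
move=> M; have bra := ract_bilin M; have bci := circ_bilin M.
apply: (@coquasi_hopf_module_eq _ _ _ _ (of_hopf (to_hopf M)) M erefl) => m x /=.
  by rewrite /res_ract crossed_act_pure // circ_one.
by rewrite /res_circ crossed_act_pure // ract_one.
Qed.

Lemma of_hopfK : cancel (@of_hopf k H R S) (@to_hopf k H R S).
Proof.
move=> N; apply: (@hopf_module_eq _ _ _ (to_hopf (of_hopf N)) N erefl).
move=> n x /=; symmetry.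
apply: crossed_act_res; [exact: hact_bilin | exact: hact_quasi_assoc].
Qed.

End Inverse.

Theorem theorem19 (k : fieldType) (H : coquasi_bialgebra k) (R : algebra k)
    (S : crossed_system H R) :
  isomorphic_categories (coquasi_hopf_module_cat S)
    (hopf_module_cat (crossed_product S)).
Proof.
exists (to_hopf_functor S), (of_hopf_functor S); split.
- apply: (@functor_eq_id (coquasi_hopf_module_cat S) (comodule H)
    (fun A B => A -> B) (fun M : coquasi_hopf_module S => M : comodule H)
    (fun M N (f : coquasi_hopf_module_hom M N) => f : M -> N)
    (comp_functor (of_hopf_functor S) (to_hopf_functor S)) (fun _ => erefl)) => //.
  + by move=> X Y f g e; apply: chm_hom_ext => x; rewrite e.
  + exact: to_hopfK.
- apply: (@functor_eq_id (hopf_module_cat (crossed_product S)) (comodule H)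
    (fun A B => A -> B) (fun M : hopf_module (crossed_product S) => M : comodule H)
    (fun M N (f : hopf_module_hom M N) => f : M -> N)
    (comp_functor (to_hopf_functor S) (of_hopf_functor S)) (fun _ => erefl)) => //.
  + by move=> X Y f g e; apply: hm_hom_ext => x; rewrite e.
  + exact: of_hopfK.
Qed.
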